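(* For every $\theta\in\mathbb R$, $\sqrt{n}(\hat\theta_n-\theta)$ converges in distribution, as $n\to\infty$, to the normal distribution $N\!\left(0,\dfrac{m+1}{m(2m-1)}\right)$.
   Context: Fix $m>1/2$. Let $c_m:=\left(\int_{\mathbb R}(1+x^2)^{-m}\,dx\right)^{-1}$ and $f(x):=c_m(1+x^2)^{-m}$. For $\theta\in\mathbb R$, $\mathrm{PVII}_m(\theta,1)$ denotes the Pearson Type VII distribution with location $\theta$ and scale $1$, i.e. the law with density $x\mapsto f(x-\theta)$. Let $(X_n)_{n\ge1}$ be i.i.d. random variables on a probability space $(\Omega,\mathcal F,P)$ with law $\mathrm{PVII}_m(\theta,1)$. For each $n$, let $\hat\theta_n(x_1,\dots,x_n)$ be any Borel measurable function on $\mathbb R^n$ such that $\hat\theta_n(x_1,\dots,x_n)$ is a maximizer of $t\mapsto\prod_{i=1}^n f(x_i-t)$ over $t\in\mathbb R$, and let $\hat\theta_n:=\hat\theta_n(X_1,\dots,X_n)$ (the maximum likelihood estimator). $N(\mu,\sigma^2)$ is the normal distribution with mean $\mu$ and variance $\sigma^2$. *)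

(* Defs.v *)
From HB Require Import structures.
From mathcomp Require Import all_boot all_order all_algebra.
From mathcomp Require Import all_classical all_reals all_analysis.
Set Implicit Arguments. Unset Strict Implicit. Unset Printing Implicit Defensive.
Import Order.TTheory GRing.Theory Num.Theory.
Import numFieldNormedType.Exports.
Local Open Scope classical_set_scope.
Local Open Scope ring_scope.

Definition pvii_c {R : realType} (m : R) : R :=
  (fine (\int[@lebesgue_measure R]_(x in [set: R]) ((1 + x ^+ 2) `^ (- m))%:E)%E)^-1.

Definition pvii_f {R : realType} (m : R) (x : R) : R :=
  pvii_c m * (1 + x ^+ 2) `^ (- m).

Definition has_law_pvii d (T : measurableType d) {R : realType}
  (P : probability T R) (X : {RV P >-> R}) (m theta : R) : Prop :=
  forall A : set R, measurable A ->
    P (X @^-1` A) = (\int[@lebesgue_measure R]_(x in A) (pvii_f m (x - theta))%:E)%E.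

Definition mutually_independent d (T : measurableType d) {R : realType}
  (P : probability T R) (X : nat -> {RV P >-> R}) : Prop :=
  forall (s : seq nat) (A : nat -> set R), uniq s ->
    (forall i, i \in s -> measurable (A i)) ->
    P (\bigcap_(i in [set` s]) (X i @^-1` A i)) =
    (\prod_(i <- s) P (X i @^-1` A i))%E.

(* the sample (X_1, ..., X_n) (0-indexed: X 0, ..., X (n-1)) as an n-tuple *)
Definition sample d (T : measurableType d) {R : realType}
  (P : probability T R) (X : nat -> {RV P >-> R}) (n : nat) (w : T) : n.-tuple R :=
  [tuple X i w | i < n].

Definition pvii_likelihood {R : realType} (m : R) (n : nat) (x : n.-tuple R) (t : R) : R :=
  \prod_(i < n) pvii_f m (tnth x i - t).

Definition cvg_in_distribution d (T : measurableType d) {R : realType}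
  (P : probability T R) (Y : nat -> T -> R) (mu : set R -> \bar R) : Prop :=
  forall x : R, {for x, continuous (fun y : R => fine (mu `]-oo, y]%classic))} ->
    (P [set w | (Y n w <= x)%R] @[n --> \oo] --> mu `]-oo, x]%classic)%E.

(* Main.v *)
Require Import Defs.
From HB Require Import structures.
From mathcomp Require Import all_boot all_order all_algebra.
From mathcomp Require Import all_classical all_reals all_analysis.
From mathcomp Require Import measurable_realfun ring lra.
Set Implicit Arguments. Unset Strict Implicit. Unset Printing Implicit Defensive.
Import Order.TTheory GRing.Theory Num.Theory.
Import numFieldNormedType.Exports.
Local Open Scope classical_set_scope.
Local Open Scope ring_scope.

(** Up to a constant the log-likelihood is the sum of [- m * ln (1 + (X_i - t)^2)]; its
    score [m * psi (X_i - t)] and all derivatives of [psi] are bounded, so only expectations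
    of bounded functions occur.

    Consistency is Wald's argument: [ln (1 + (y - s)^2) - ln (1 + y^2)] is 1-Lipschitz in [s]
    and has positive mean for [s <> 0] (Kullback-Leibler), so the weak law and compactness rule
    out [eps <= |s| <= B]; large [|s|] is ruled out by counting the observations in a
    fixed bounded interval, which needs no moment of the heavy-tailed density.

    Expanding the score equation at the true value gives
    [sqrt n * (thetahat_n - theta) = W_n * (1 + o(1))] in probability, with [W_n] the normalized
    sum of [psi (X_i - theta) / I] and [I = E psi' = (2m - 1) / (m + 1)].  As
    [E psi^2 = (2m - 1) / (m (m + 1))], the limiting variance is [(m + 1) / (m (2m - 1))].
    The moments come from integrating derivatives of [f], [y f] and [y f / (1 + y^2)].

    The central limit theorem for [W_n] is proved by Stein's method: the solution [f] of
    [s^2 f' - w f = h - E h(Z)] for a piecewise linear [h] has bounded, uniformly continuous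
    derivative (by Mills' ratio bounds), and leave-one-out Taylor expansion gives
    [E (s^2 f'(W_n) - W_n f(W_n)) -> 0]. *)

(** * Expectations of bounded functions *)

(** Under a probability measure such functions are integrable, so the closure lemmas below settle
    the integrability conditions behind linearity of expectation. *)
Definition bounded_mfun {d} {T : measurableType d} {R : realType} (g : T -> R) :=
  measurable_fun [set: T] g /\ exists M, forall x, `|g x| <= M.

Section bounded_mfun.
Context {d} {T : measurableType d} {R : realType}.
Implicit Types f g : T -> R.

Lemma bounded_mfun_cst (c : R) : bounded_mfun (fun _ : T => c).
Proof. by split => //; exists `|c|. Qed.

Lemma bounded_mfunD f g : bounded_mfun f -> bounded_mfun g ->
  bounded_mfun (fun x => f x + g x).
Proof.
move=> [mf [M hM]] [mg [N hN]]; split; first exact: measurable_funD.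
exists (M + N) => x; exact: le_trans (ler_normD _ _) (lerD (hM x) (hN x)).
Qed.

Lemma bounded_mfunM f g : bounded_mfun f -> bounded_mfun g ->
  bounded_mfun (fun x => f x * g x).
Proof.
move=> [mf [M hM]] [mg [N hN]]; split; first exact: measurable_funM.
by exists (M * N) => x; rewrite normrM ler_pM.
Qed.

Lemma bounded_mfunZ (k : R) g : bounded_mfun g -> bounded_mfun (fun x => k * g x).
Proof. by apply: bounded_mfunM; exact: bounded_mfun_cst. Qed.

Lemma bounded_mfunN g : bounded_mfun g -> bounded_mfun (fun x => - g x).
Proof.
move=> [mg [N hN]]; split; first exact: measurableT_comp.
by exists N => x; rewrite normrN.
Qed.

Lemma bounded_mfunB f g : bounded_mfun f -> bounded_mfun g ->
  bounded_mfun (fun x => f x - g x).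
Proof. by move=> bf bg; apply: bounded_mfunD => //; exact: bounded_mfunN. Qed.

Lemma bounded_mfun_norm g : bounded_mfun g -> bounded_mfun (fun x => `|g x|).
Proof.
move=> [mg [N hN]]; split; first exact: measurableT_comp.
by exists N => x; rewrite normr_id.
Qed.

Lemma bounded_mfun_sum (I : Type) (s : seq I) (g : I -> T -> R) :
  (forall i, bounded_mfun (g i)) -> bounded_mfun (fun x => \sum_(i <- s) g i x).
Proof.
move=> bg; elim: s => [|i s ih].
  by under [X in bounded_mfun X]eq_fun do rewrite big_nil; exact: bounded_mfun_cst.
by under [X in bounded_mfun X]eq_fun do rewrite big_cons; exact: bounded_mfunD.
Qed.

Lemma bounded_mfun_indic (A : set T) : measurable A ->
  bounded_mfun (\1_A : T -> R).
Proof.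
move=> mA; split; first exact: measurable_indic.
by exists 1 => x; rewrite indicE; case: (_ \in _); rewrite ?normr1 ?normr0.
Qed.

Lemma bounded_mfun_comp {d'} {T' : measurableType d'} (f : T' -> R) (h : T -> T') :
  bounded_mfun f -> measurable_fun setT h -> bounded_mfun (f \o h).
Proof.
move=> [mf [M hM]] mh; split; first exact: measurableT_comp.
by exists M => x; exact: hM.
Qed.

End bounded_mfun.

Section bounded_expectation.
Context {d} {T : measurableType d} {R : realType} (P : probability T R).
Implicit Types f g : T -> R.

Lemma bounded_mfun_integrable g : bounded_mfun g ->
  P.-integrable [set: T] (EFin \o g).
Proof.
move=> [mg [M hM]]; apply: measurable_bounded_integrable => //.
  by rewrite (le_lt_trans (probability_le1 _ measurableT)) ?ltry.
exists M; split; first exact: num_real.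
by move=> y My x _; exact: le_trans (hM x) (ltW My).
Qed.

Lemma bexpD f g : bounded_mfun f -> bounded_mfun g ->
  \int[P]_x (f x + g x) = \int[P]_x f x + \int[P]_x g x.
Proof. by move=> *; rewrite RintegralD//; exact: bounded_mfun_integrable. Qed.

Lemma bexpB f g : bounded_mfun f -> bounded_mfun g ->
  \int[P]_x (f x - g x) = \int[P]_x f x - \int[P]_x g x.
Proof. by move=> *; rewrite RintegralB//; exact: bounded_mfun_integrable. Qed.

Lemma bexpZ (k : R) g : bounded_mfun g ->
  \int[P]_x (k * g x) = k * \int[P]_x g x.
Proof. by move=> *; rewrite RintegralZl//; exact: bounded_mfun_integrable. Qed.

Lemma bexp_cst (k : R) : \int[P]_x k = k.
Proof. by rewrite Rintegral_cst// [X in fine X](_ : _ = 1%E) ?mulr1//; exact: probability_setT. Qed.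

Lemma bexp_sum (I : Type) (s : seq I) (g : I -> T -> R) :
  (forall i, bounded_mfun (g i)) ->
  \int[P]_x (\sum_(i <- s) g i x) = \sum_(i <- s) \int[P]_x g i x.
Proof.
move=> bg; elim: s => [|i s ih].
  by under eq_Rintegral do rewrite big_nil; rewrite bexp_cst big_nil.
under eq_Rintegral do rewrite big_cons.
by rewrite bexpD ?big_cons ?ih//; exact: bounded_mfun_sum.
Qed.

Lemma le_bexp f g : bounded_mfun f -> bounded_mfun g ->
  (forall x, f x <= g x) -> \int[P]_x f x <= \int[P]_x g x.
Proof. by move=> *; apply: le_Rintegral => //; exact: bounded_mfun_integrable. Qed.

Lemma bexp_norm_le f (c : R) : bounded_mfun f -> (forall x, `|f x| <= c) ->
  `|\int[P]_x f x| <= c.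
Proof.
move=> bf fc.
apply: (@le_trans _ _ (\int[P]_x `|f x|)).
  by apply: le_normr_Rintegral => //; exact: bounded_mfun_integrable.
rewrite -[leRHS]bexp_cst; apply: le_bexp => //; first exact: bounded_mfun_norm.
exact: bounded_mfun_cst.
Qed.

Lemma bexp_indic (A : set T) : measurable A ->
  \int[P]_x \1_A x = fine (P A).
Proof. by move=> mA; rewrite /Rintegral integral_indic// setIT. Qed.

End bounded_expectation.

(** * Independence and laws of pairs *)

(** Measurable rectangles are stable under intersection and generate the product sigma-algebra; as
    [m1] is finite, the constant sequence of the whole space serves as exhaustion. *)
Lemma measure_eq_on_rectangles {d1 d2} {T1 : measurableType d1}
    {T2 : measurableType d2} {R : realType}
    (m1 m2 : {measure set (T1 * T2) -> \bar R}) :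
  (m1 setT < +oo)%E ->
  (forall A B, measurable A -> measurable B -> m1 (A `*` B) = m2 (A `*` B)) ->
  forall C, measurable C -> m1 C = m2 C.
Proof.
move=> m1oo m12 C mC.
pose G : set (set (T1 * T2)) :=
  [set C | exists A, measurable A /\ exists B, measurable B /\ C = A `*` B].
apply: (measure_unique G (fun _ => setT)) => //.
- rewrite measurable_prod_measurableType //; congr (<<s _ >>).
  rewrite predeqE; split => [[A mA [B mB <-]]|[A [mA [B [mB ->]]]]].
    by exists A; split => //; exists B.
  by exists A => //; exists B.
- move=> /= _ _ [X1 [mX1 [X2 [mX2 ->]]]] [Y1 [mY1 [Y2 [mY2 ->]]]].
  rewrite -setXI; exists (X1 `&` Y1); split; first exact: measurableI.
  by exists (X2 `&` Y2); split => //; exact: measurableI.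
- move=> i; exists setT; split => //; exists setT; split => //.
  by rewrite setXTT.
- by rewrite bigcup_const.
- by move=> A [A1 [mA1 [A2 [mA2 ->]]]]; exact: m12.
Qed.

Section independence.
Context {d} {T : measurableType d} {R : realType} (P : probability T R).

Definition independent_pair (U V : T -> R) := forall A B : set R,
  measurable A -> measurable B ->
  P (U @^-1` A `&` V @^-1` B) = (P (U @^-1` A) * P (V @^-1` B))%E.

Lemma bexp_distribution {d'} {T' : measurableType d'} (Z : {RV P >-> T'})
  (k : T' -> R) :
  bounded_mfun k -> \int[P]_w k (Z w) = \int[distribution P Z]_x k x.
Proof.
move=> bk; rewrite /Rintegral; congr fine; symmetry.
apply: (integral_distribution (f := EFin \o k)); first exact/measurable_EFinP/bk.1.
exact: (@bounded_mfun_integrable _ _ _ P (k \o Z) (bounded_mfun_comp bk _)).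
Qed.

(** The law of the pair agrees with the product of the two laws on rectangles, hence on all
    measurable sets; Fubini's theorem then separates the factors. *)
Lemma bexpM_independent (U V : {RV P >-> R}) (f g : R -> R) :
  independent_pair U V -> bounded_mfun f -> bounded_mfun g ->
  \int[P]_w (f (U w) * g (V w)) = \int[P]_w f (U w) * \int[P]_w g (V w).
Proof.
move=> UV bf bg.
have mUV : measurable_fun setT (fun w => (U w, V w)) by exact: measurable_fun_pair.
pose UVm := isMeasurableFun.Build _ _ _ _ _ mUV.
pose UVp : {mfun T >-> (R * R)%type} := HB.pack (fun w => (U w, V w)) UVm.
pose mu1 := distribution P U; pose mu2 := distribution P V.
have prodE C : measurable C -> (mu1 \x mu2)%E C = distribution P UVp C.
  by apply: product_measure_unique => A B mA mB; rewrite -UV.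
pose h (z : R * R) := f z.1 * g z.2.
have bh : bounded_mfun h.
  by apply: bounded_mfunM; apply: (bounded_mfun_comp (f := _) (h := _)).
rewrite (bexp_distribution _ bf) (bexp_distribution _ bg) (bexp_distribution UVp bh).
transitivity (fine (\int[(mu1 \x mu2)%E]_z (h z)%:E)%E).
  by congr fine; apply: eq_measure_integral => C mC _; exact/esym/prodE.
have ih : (mu1 \x mu2)%E.-integrable setT (EFin \o h).
  case: bh => mh [M hM]; apply: measurable_bounded_integrable => //.
    rewrite [ltLHS](_ : _ = 1%E) ?ltry//; apply: (etrans (prodE _ measurableT)).
    exact: (probability_setT (distribution P UVp)).
  exists M; split; first exact: num_real.
  by move=> y My x _; exact: le_trans (hM x) (ltW My).
rewrite -(integral12_prod_meas1 ih).
transitivity (\int[mu1]_x (\int[mu2]_y g y * f x)); last first.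
  by rewrite (bexpZ _ _ bf) mulrC.
congr fine; apply: eq_integral => x _.
rewrite mulrC -(bexpZ mu2 _ bg) /Rintegral fineK//.
by apply: integrable_fin_num => //; exact: bounded_mfun_integrable (bounded_mfunZ _ bg).
Qed.
End independence.

Section independent_sums.
Context {d} {T : measurableType d} {R : realType} (P : probability T R).
Variable X : nat -> {RV P >-> R}.
Hypothesis hind : mutually_independent X.
Variable g : R -> R.
Hypothesis mg : measurable_fun setT g.

Let S s (w : T) := \sum_(i <- s) g (X i w).

Lemma measurable_sum_RV s : measurable_fun setT (S s).
Proof.
elim: s => [|i s ih].
  by rewrite (_ : S [::] = cst 0)//; apply/funext => w; rewrite /S big_nil.
rewrite (_ : S (i :: s) = (fun w => g (X i w) + S s w)); last first.
  by apply/funext => w; rewrite /S big_cons.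
by apply: measurable_funD => //; exact: measurableT_comp.
Qed.

Let E (A : nat -> set R) (t : seq nat) := \bigcap_(i in [set` t]) (X i @^-1` A i).

Let measurable_E A t : (forall i, i \in t -> measurable (A i)) -> measurable (E A t).
Proof.
move=> mA; rewrite /E bigcap_seq big_seq; apply: bigsetI_measurable => i it.
by rewrite -[X in measurable X]setTI; apply: measurable_funP => //; exact: mA.
Qed.

Let E_cons A i t : E A (i :: t) = X i @^-1` A i `&` E A t.
Proof. by rewrite /E !bigcap_seq big_cons. Qed.

Let eq_E A A' t : {in t, A =1 A'} -> E A t = E A' t.
Proof.
move=> AA'; rewrite /E !bigcap_seq big_seq [RHS]big_seq.
by apply: eq_bigr => i it; rewrite AA'.
Qed.

Let P_E_cons A i t : uniq (i :: t) ->
  (forall j, j \in i :: t -> measurable (A j)) ->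
  P (E A (i :: t)) = (P (X i @^-1` A i) * P (E A t))%E.
Proof.
move=> /= it mA; rewrite /E !hind//; first by rewrite big_cons.
  by case/andP: it.
by move=> j jt; apply: mA; rewrite inE jt orbT.
Qed.

(** Independence is given only for events on single variables, so the sum is built one term at a
    time. The list [t] stays general: to add [i] to the sum, the induction hypothesis is applied
    with [i] among the remaining indices. This gives the joint law of [X i] and the shorter sum on
    [E A t], first on rectangles, then on the whole plane. *)
Let sum_rect_indep s t A B : uniq (s ++ t) ->
  (forall i, i \in t -> measurable (A i)) -> measurable B ->
  P (S s @^-1` B `&` E A t) = (P (S s @^-1` B) * P (E A t))%E.
Proof.
elim: s t A B => [|i s ih] t A B ust mA mB.
  have S0 : S [::] = cst 0 by apply/funext => w; rewrite /S big_nil.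
  rewrite S0 preimage_cst; case: ifPn => _; first by rewrite setTI probability_setT mul1e.
  by rewrite set0I measure0 mul0e.
have ust' : uniq (s ++ i :: t) by rewrite -cat1s uniq_catCA.
have ut : uniq (i :: t) by move: ust'; rewrite cat_uniq => /and3P[].
(* [A'] puts [B1] at index [i]; as [i] is not in [t], nothing changes on [t]. *)
pose A' B1 j := if j == i then B1 else A j.
have A't B1 : {in t, A' B1 =1 A}.
  by move=> j jt; rewrite /A'; case: eqP => // ji; move: ut; rewrite -ji /= jt.
have mA' B1 : measurable B1 -> forall j, j \in i :: t -> measurable (A' B1 j).
  by move=> mB1 j; rewrite inE /A'; case: eqP => //= _; exact: mA.
have mSs := measurable_sum_RV s.
have mXS : measurable_fun setT (fun w => (X i w, S s w)) by exact: measurable_fun_pair.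
pose XSm := isMeasurableFun.Build _ _ _ _ _ mXS.
pose XS : {mfun T >-> (R * R)%type} := HB.pack (fun w => (X i w, S s w)) XSm.
have mE := measurable_E mA.
(* [m1] is the law of [(X i, S s)] restricted to [E A t], and [m2] its full law scaled by
   [P (E A t)]; their equality is the independence of the pair from [E A t]. *)
pose m1 := pushforward (mrestr P mE) XS.
have PE0 : 0 <= fine (P (E A t)) by exact: fine_ge0.
pose m2 := pushforward (mscale (NngNum PE0) P) XS.
have key C : measurable C -> m1 C = m2 C.
  apply: measure_eq_on_rectangles => [|B1 B2 mB1 mB2].
    apply: (@le_lt_trans _ _ (P (setT `&` E A t))%E); first exact: lexx.
    by rewrite setTI (le_lt_trans (probability_le1 _ mE)) ?ltry.
  change (P ((X i @^-1` B1 `&` S s @^-1` B2) `&` E A t) =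
    ((fine (P (E A t)))%:E * P (X i @^-1` B1 `&` S s @^-1` B2))%E).
  rewrite fineK; last exact: fin_num_measure.
  (* [h1] factors the rectangle together with [E A t], [h2] the rectangle alone; comparing them
     isolates the factor [P (E A t)]. *)
  have h1 := ih (i :: t) (A' B1) B2 ust' (mA' _ mB1) mB2.
  have us1 : uniq (s ++ [:: i]).
    by move: ust'; rewrite !cat_uniq /= => /and3P[-> /norP[/negbTE -> _] _].
  have h2 := ih [:: i] (A' B1) B2 us1 _ mB2.
  have E1 : E (A' B1) [:: i] = X i @^-1` B1.
    by rewrite /E bigcap_seq big_seq1 /A' eqxx.
  move: h1; rewrite P_E_cons//; last exact: mA'.
  rewrite E_cons (eq_E (A't _)) /A' eqxx => h1.
  move: h2; rewrite E1 => h2.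
  rewrite [X i @^-1` B1 `&` _]setIC -setIA h1 h2; last first.
    by move=> j; rewrite inE => /eqP ->; rewrite /A' eqxx.
  by rewrite muleA [RHS]muleC.
have mC : measurable [set z : R * R | B (g z.1 + z.2)].
  rewrite -[X in measurable X]setTI.
  apply: (measurable_funD (f := fun z : R * R => g z.1) (g := snd)) => //.
  exact: measurableT_comp.
have := key _ mC.
set C := [set z : R * R | B (g z.1 + z.2)].
change (m1 C) with (P (XS @^-1` C `&` E A t)).
change (m2 C) with ((fine (P (E A t)))%:E * P (XS @^-1` C))%E.
rewrite fineK; last exact: fin_num_measure.
have -> : XS @^-1` C = S (i :: s) @^-1` B.
  by apply/seteqP; split => w; rewrite /preimage/= /S big_cons.
by move=> ->; rewrite muleC.
Qed.

Lemma sum_RV_independent s i : uniq (i :: s) -> independent_pair P (X i) (S s).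
Proof.
move=> us A B mA mB.
have := @sum_rect_indep s [:: i] (fun=> A) B _ _ mB.
rewrite /E bigcap_seq big_seq1 cats1 rcons_uniq setIC muleC; apply => //.
Qed.

End independent_sums.

(** * Weak law of large numbers *)

(** Events holding with probability tending to one, expressed through measurable exceptional sets,
    so that [A n] may be quantified over uncountably many parameters. *)
Definition whp {d} {T : measurableType d} {R : realType} (P : probability T R)
    (A : nat -> set T) :=
  exists E : nat -> set T, [/\ forall n, measurable (E n),
    fine (P (E n)) @[n --> \oo] --> (0 : R) &
    \forall n \near \oo, ~` E n `<=` A n].

Section whp.
Context {d} {T : measurableType d} {R : realType} (P : probability T R).

Lemma whpI (A B : nat -> set T) : whp P A -> whp P B ->
  whp P (fun n => A n `&` B n).
Proof.
move=> [E [mE cE EA]] [F [mF cF FB]]; exists (fun n => E n `|` F n); split.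
- by move=> n; exact: measurableU.
- apply: (@squeeze_cvgr _ _ _ _ (cst 0) (fun n => fine (P (E n)) + fine (P (F n)))).
  + apply: nearW => n; rewrite fine_ge0//= -fineD ?fin_num_measure//.
    rewrite fine_le ?fin_num_measure//; last exact: measureU2.
      exact: measurableU.
    by rewrite fin_numD !fin_num_measure.
  + exact: cvg_cst.
  + by rewrite -[X in _ --> X](addr0 (0 : R)); exact: cvgD.
- near=> n; rewrite setCU; apply: setISS.
    by near: n.
  by near: n.
Unshelve. all: end_near. Qed.

Lemma whpS (A B : nat -> set T) : whp P A ->
  (\forall n \near \oo, A n `<=` B n) -> whp P B.
Proof.
move=> [E [mE cE EA]] AB; exists E; split => //.
by apply: filterS2 EA AB => n; exact: subset_trans.
Qed.

Lemma whpT : whp P (fun=> setT).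
Proof.
exists (fun=> set0); split => //; last exact: nearW.
by rewrite measure0; exact: cvg_cst.
Qed.

End whp.

Section iid.
Context {d} {T : measurableType d} {R : realType} (P : probability T R).
Variable X : nat -> {RV P >-> R}.
Hypothesis hind : mutually_independent X.
Hypothesis hid : forall i (A : set R), measurable A ->
  P (X i @^-1` A) = P (X 0%N @^-1` A).

Let mu := distribution P (X 0%N).

Lemma bexp_iid (g : R -> R) i : bounded_mfun g -> \int[P]_w g (X i w) = \int[mu]_x g x.
Proof.
move=> bg; rewrite bexp_distribution// /Rintegral; congr fine.
by apply: eq_measure_integral => A mA _; exact: hid.
Qed.

Lemma bounded_mfun_RV (g : R -> R) i : bounded_mfun g -> bounded_mfun (fun w => g (X i w)).
Proof. by move=> bg; exact: (bounded_mfun_comp bg). Qed.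

Lemma bexpM_iid (f g : R -> R) i j : i != j -> bounded_mfun f -> bounded_mfun g ->
  \int[P]_w (f (X i w) * g (X j w)) = \int[mu]_x f x * \int[mu]_x g x.
Proof.
move=> ij bf bg; rewrite bexpM_independent// ?bexp_iid//.
(* [X j] is read as a one-term sum, to which the independence of sums applies. *)
rewrite (_ : (X j : T -> R) = (fun w => \sum_(k <- [:: j]) id (X k w))).
  by apply: (@sum_RV_independent _ _ _ P X hind id _ [:: j] i) => /=; rewrite ?inE ?ij//; exact: measurable_id.
by apply/funext => w; rewrite big_seq1.
Qed.

(** By induction on [n]: independence and the zero mean kill the cross terms, and each new square is
    at most [M ^+ 2]. *)
Lemma second_moment_sum (g : R -> R) (M : R) n : bounded_mfun g -> (forall x, `|g x| <= M) ->
  \int[mu]_x g x = 0 ->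
  \int[P]_w (\sum_(0 <= i < n) g (X i w)) ^+ 2 <= n%:R * M ^+ 2.
Proof.
move=> bg gM g0.
have bgX i := bounded_mfun_RV i bg.
elim: n => [|n ih].
  under eq_Rintegral do rewrite big_nil expr0n/=.
  by rewrite bexp_cst mul0r.
under eq_Rintegral do rewrite big_nat_recr//= sqrrD addrAC -mulr_natl.
have bS : bounded_mfun (fun w => \sum_(0 <= i < n) g (X i w)).
  exact: bounded_mfun_sum.
have bSg : bounded_mfun (fun w => (\sum_(0 <= i < n) g (X i w)) * g (X n w)).
  exact: bounded_mfunM.
rewrite bexpD; last 2 first.
- by apply: bounded_mfunD; [exact: (bounded_mfunM bS bS)|exact: (bounded_mfunM (bgX n) (bgX n))].
- exact: bounded_mfunZ.
rewrite bexpD; [|exact: (bounded_mfunM bS bS)|exact: (bounded_mfunM (bgX n) (bgX n))].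
rewrite bexpZ//.
under [X in _ + 2 * X]eq_Rintegral do rewrite mulr_suml.
rewrite bexp_sum; last by move=> i; exact: bounded_mfunM.
rewrite big_nat_cond big1 ?mulr0 ?addr0; last first.
  move=> i /andP[/andP[_ ilt] _]; rewrite bexpM_iid// ?g0 ?mul0r//.
  by rewrite neq_ltn ilt.
rewrite -natr1 mulrDl mul1r lerD//.
rewrite -[leRHS](bexp_cst P); apply: le_bexp.
- exact: (bounded_mfunM (bgX n) (bgX n)).
- exact: bounded_mfun_cst.
- by move=> w; rewrite -[g _ ^+ 2]real_normK ?num_real// ler_sqr ?nnegrE//; exact: le_trans (gM 0).
Qed.

(** Chebyshev's inequality for the centered sum: a second moment of order at most [n] against a
    threshold [e * n] leaves a probability of order at most [1 / n]. *)
Lemma weak_law (g : R -> R) (e : R) : bounded_mfun g -> 0 < e ->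
  whp P (fun n => [set w |
    `|n%:R^-1 * \sum_(0 <= i < n) g (X i w) - \int[mu]_x g x| < e]).
Proof.
move=> bg e0; set c := \int[mu]_x g x.
pose g0 x := g x - c.
have bg0 : bounded_mfun g0 by apply: bounded_mfunB => //; exact: bounded_mfun_cst.
have g00 : \int[mu]_x g0 x = 0.
  by rewrite bexpB// ?bexp_cst ?subrr//; exact: bounded_mfun_cst.
have [M gM] := bg0.2.
pose S n w := \sum_(0 <= i < n) g0 (X i w).
have bS n : bounded_mfun (S n).
  by apply: bounded_mfun_sum => i; exact: bounded_mfun_RV.
pose E n := [set w | e * n%:R <= `|S n w|].
have mE n : measurable (E n).
  rewrite -[X in measurable X]setTI.
  rewrite (_ : E n = (fun w => `|S n w|) @^-1` `[e * n%:R, +oo[); last first.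
    by apply/seteqP; split => w /=; rewrite in_itv/= andbT.
  by apply: (bounded_mfun_norm (bS n)).1.
exists E; split => //; last first.
  near=> n => w /= /negP; rewrite -ltNge => Sn.
  have n0 : 0 < n%:R :> R by rewrite ltr0n; near: n; exact: nbhs_infty_gt.
  have -> : n%:R^-1 * \sum_(0 <= i < n) g (X i w) - c = n%:R^-1 * S n w.
    rewrite /S big_split/= sumrN big_const_nat subn0 iter_addr_0 mulrBr.
    by rewrite -[c *+ n]mulr_natl mulKf// gt_eqF.
  by rewrite normrM gtr0_norm ?invr_gt0// mulrC ltr_pdivrMr.
have key n : (0 < n)%N -> fine (P (E n)) <= M ^+ 2 / e ^+ 2 * n%:R^-1.
  move=> n0; have n0' : 0 < n%:R :> R by rewrite ltr0n.
  have := second_moment_sum n bg0 gM g00.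
  have bS2 : bounded_mfun (fun w => S n w ^+ 2) by exact: (bounded_mfunM (bS n) (bS n)).
  have : (e * n%:R) ^+ 2 * fine (P (E n)) <= \int[P]_w (S n w) ^+ 2.
    rewrite -bexp_indic// -bexpZ; last exact: bounded_mfun_indic.
    apply: le_bexp => //; first by apply: bounded_mfunZ; exact: bounded_mfun_indic.
    move=> w; rewrite indicE; case: (boolP (w \in E n)); last first.
      by rewrite mulr0 sqr_ge0.
    rewrite inE /E/= mulr1 => eS; rewrite -[leRHS]real_normK ?num_real//.
    by rewrite ler_sqr ?nnegrE// mulr_ge0 ?ltW.
  move=> h1 h2; have h := le_trans h1 h2.
  rewrite mulrAC ler_pdivlMr ?exprn_gt0// ler_pdivlMr// mulrC.
  rewrite -(ler_pM2l n0') (le_trans _ h)// le_eqVlt; apply/orP; left; apply/eqP; ring.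
apply: (@squeeze_cvgr _ _ _ _ (cst 0) (fun n => M ^+ 2 / e ^+ 2 * n%:R^-1)).
- near=> n; rewrite fine_ge0//=; apply: key; near: n; exact: nbhs_infty_gt.
- exact: cvg_cst.
- rewrite -[X in _ --> X](mulr0 (M ^+ 2 / e ^+ 2)).
  by apply: cvgMl_tmp; rewrite gtr0_cvgV0//; [exact: cvgr_idn|near=> n; rewrite ltr0n; near: n; exact: nbhs_infty_gt].
Unshelve. all: end_near. Qed.

End iid.

(** * Stein's identity *)

(** By the mean value theorem the increment is [h * df c] for some [c] closer to [u] than [del]. The
    assumption is a modulus of continuity for [df], since the solution of Stein's equation for a
    ramp has no second derivative at the corners. *)
Lemma taylor1_le {R : realType} (f df : R -> R) (e del u h : R) :
  (forall x : R, is_derive x 1 f (df x)) ->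
  (forall x y, `|x - y| < del -> `|df x - df y| <= e) -> `|h| < del ->
  `|f (u + h) - f u - h * df u| <= `|h| * e.
Proof.
move=> fdf ucdf hdel.
have cf : continuous f.
  by move=> x; apply: differentiable_continuous; apply/derivable1_diffP; exact: (@ex_derive _ _ _ _ _ _ _ (fdf x)).
have mvt (a b : R) : a < b -> exists2 c, a < c < b & f b - f a = df c * (b - a).
  move=> ab; have [|c cab ->] := @MVT R f df a b ab (fun x _ => fdf x).
    exact: continuous_subspaceT.
  by exists c => //; move: cab; rewrite in_itv.
have [h0|h0|->] := ltgtP h 0; last by rewrite addr0 subrr mul0r subr0 normr0 mul0r.
- have [|c /andP[c1 c2] E] := mvt (u + h) u; first by lra.
  have -> : f (u + h) - f u - h * df u = h * (df c - df u) by lra.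
  rewrite normrM ler_wpM2l// ucdf//; rewrite ltr0_norm// in hdel.
  by rewrite ltr0_norm; lra.
- have [|c /andP[c1 c2] E] := mvt u (u + h); first by lra.
  have -> : f (u + h) - f u - h * df u = h * (df c - df u) by lra.
  rewrite normrM ler_wpM2l// ucdf//; rewrite gtr0_norm// in hdel.
  by rewrite gtr0_norm; lra.
Qed.

Section stein.
Context {d} {T : measurableType d} {R : realType} (P : probability T R).
Variable X : nat -> {RV P >-> R}.
Hypothesis hind : mutually_independent X.
Hypothesis hid : forall i (A : set R), measurable A ->
  P (X i @^-1` A) = P (X 0%N @^-1` A).
Let mu := distribution P (X 0%N).
Variables (g : R -> R) (v : R).
Hypothesis bg : bounded_mfun g.
Hypothesis g0 : \int[mu]_x g x = 0.
Hypothesis gv : \int[mu]_x (g x) ^+ 2 = v.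

Definition normalized_sum n w := (Num.sqrt n%:R)^-1 * \sum_(0 <= i < n) g (X i w).
Local Notation W := normalized_sum.

Lemma bounded_normalized_sum n : bounded_mfun (W n).
Proof.
by apply: bounded_mfunZ; apply: bounded_mfun_sum => i; exact: (bounded_mfun_RV X i bg).
Qed.

(** Each term [g (X i) * f (W n)] is expanded around the normalized sum without its [i]-th term,
    which is independent of [X i]. The order-zero part vanishes with the mean of [g], the
    first-order part yields [v] times the mean of [df], and after normalization each of the [n]
    remainders is at most [e / n]. *)
Lemma stein_identity (f df : R -> R) :
  (forall x : R, is_derive x 1 f (df x)) ->
  bounded_mfun f -> bounded_mfun df ->
  (forall e, 0 < e -> exists2 del, 0 < del &
     forall x y, `|x - y| < del -> `|df x - df y| <= e) ->
  \int[P]_w (v * df (W n w) - W n w * f (W n w)) @[n --> \oo] --> (0 : R).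
Proof.
move=> fdf bf bdf ucdf.
have [M0 gM0] := bg.2.
have [M M_gt0 gM] : exists2 M, 0 < M & forall x, `|g x| <= M.
  exists (`|M0| + 1); first by rewrite ltr_pwDr.
  move=> x; rewrite (le_trans (gM0 x))// (le_trans (ler_norm _))//.
  by rewrite lerDl.
apply/cvgrPdist_le => /= e e0.
have K_gt0 : 0 < M ^+ 2 + `|v| by rewrite ltr_pwDl// exprn_gt0.
(* Two errors occur per term, with weights [M ^+ 2] and [|v|]; dividing [e] by the sum of the
   weights makes them add up to [r ^+ 2 * e]. *)
have [del del0 hdel] := ucdf (e / (M ^+ 2 + `|v|)) (divr_gt0 e0 K_gt0).
set eta := e / _ in hdel.
near=> n; rewrite sub0r normrN.
have n0 : 0 < n%:R :> R by rewrite ltr0n; near: n; exact: nbhs_infty_gt.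
pose r := (Num.sqrt n%:R : R)^-1.
have r0 : 0 < r by rewrite invr_gt0 sqrtr_gt0.
have nr2 : n%:R * r ^+ 2 = 1 by rewrite exprVn sqr_sqrtr ?ltW// divff// gt_eqF.
(* For large [n] a single term moves the normalized sum by less than [del]. *)
have rM : r * M < del.
  rewrite mulrC ltr_pdivrMr ?sqrtr_gt0// mulrC -ltr_pdivrMr//.
  rewrite -(@ger0_norm _ (M / del)) ?divr_ge0 ?ltW// -sqrtr_sqr ltr_sqrt//.
  near: n; exact: nbhs_infty_gtr.
have bW := bounded_normalized_sum n.
have bc (h : R -> R) : bounded_mfun h -> bounded_mfun (fun w => h (W n w)).
  by move=> bh; exact: (bounded_mfun_comp bh bW.1).
have bgX i := bounded_mfun_RV X i bg.
pose V i w := \sum_(j <- rem i (index_iota 0 n)) g (X j w).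
have mV i : measurable_fun setT (V i).
  exact: (measurable_sum_RV X bg.1).
have bV i (h : R -> R) : bounded_mfun h -> bounded_mfun (fun w => h (r * V i w)).
  move=> bh; apply: (bounded_mfun_comp bh); exact: measurable_funM.
have WV i w : (i < n)%N -> W n w = r * V i w + r * g (X i w).
  move=> i_lt; rewrite /W (big_rem i)/=; last by rewrite mem_index_iota.
  by rewrite mulrDr addrC.
have indep i (k h : R -> R) : (i < n)%N -> bounded_mfun k -> bounded_mfun h ->
    \int[P]_w (k (X i w) * h (r * V i w)) =
    \int[mu]_x k x * \int[P]_w h (r * V i w).
  move=> i_lt bk bh.
  pose Vm := isMeasurableFun.Build _ _ _ _ _ (mV i).
  pose Vp : {mfun T >-> R} := HB.pack (V i) Vm.
  have bh' : bounded_mfun (fun x => h (r * x)).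
    by apply: (bounded_mfun_comp bh); exact: measurable_funM.
  rewrite (@bexpM_independent _ _ _ P (X i) Vp k (fun x => h (r * x)))//.
    by rewrite (bexp_iid hid i bk).
  apply: sum_RV_independent => //; first exact: bg.1.
  by rewrite /= mem_rem_uniq ?iota_uniq// inE/= eqxx/= rem_uniq// iota_uniq.
have step i : (i < n)%N ->
    `|r * \int[P]_w (g (X i w) * f (W n w)) - r ^+ 2 * (v * \int[P]_w df (W n w))|
    <= r ^+ 2 * e.
  move=> i_lt.
  have b1 : bounded_mfun (fun w => g (X i w) * f (W n w)) by apply: bounded_mfunM => //; exact: bc.
  have b2 : bounded_mfun (fun w => g (X i w) * f (r * V i w)) by apply: bounded_mfunM => //; exact: bV.
  have bg2 : bounded_mfun (fun x => g x ^+ 2) by exact: (bounded_mfunM bg bg).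
  have b3 : bounded_mfun (fun w => g (X i w) ^+ 2 * df (r * V i w)).
    apply: bounded_mfunM; last exact: bV.
    exact: (bounded_mfun_RV X i bg2).
  have e2 := indep i g f i_lt bg bf; rewrite g0 mul0r in e2.
  have e3 := indep i _ df i_lt bg2 bdf; rewrite gv in e3.
  have h1 : `|\int[P]_w (g (X i w) * f (W n w) - g (X i w) * f (r * V i w)
       - r * (g (X i w) ^+ 2 * df (r * V i w)))| <= r * M ^+ 2 * eta.
    apply: bexp_norm_le.
      by apply: bounded_mfunB; [exact: bounded_mfunB|exact: bounded_mfunZ].
    move=> w; rewrite (WV i)//.
    have rg : `|r * g (X i w)| <= r * M by rewrite normrM gtr0_norm// ler_wpM2l// ltW.
    have := taylor1_le (r * V i w) fdf hdel (le_lt_trans rg rM).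
    set D := f _ - f _ - _ => hD.
    have -> : g (X i w) * f (r * V i w + r * g (X i w)) - g (X i w) * f (r * V i w) -
      r * (g (X i w) ^+ 2 * df (r * V i w)) = g (X i w) * D by rewrite /D; ring.
    rewrite normrM (_ : r * M ^+ 2 * eta = M * (r * M * eta)); last by ring.
    apply: ler_pM => //; apply: le_trans hD _; apply: ler_wpM2r => //.
    by rewrite divr_ge0 ?ltW.
  rewrite bexpB in h1; [|exact: bounded_mfunB|exact: bounded_mfunZ].
  rewrite bexpB// e2 subr0 bexpZ// e3 in h1.
  (* This returns from the leave-one-out sum to [W n] inside [df]. *)
  have h2 : `|\int[P]_w (df (r * V i w) - df (W n w))| <= eta.
    apply: bexp_norm_le; first by apply: bounded_mfunB; [exact: bV|exact: bc].
    move=> w; apply: hdel; rewrite (WV i)// opprD addNKr normrN.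
    by rewrite normrM gtr0_norm// (le_lt_trans _ rM)// ler_wpM2l// ltW.
  rewrite bexpB in h2; [|exact: bV|exact: bc].
  set a := \int[P]_w (g (X i w) * f (W n w)) in h1 *.
  set b := \int[P]_w df (r * V i w) in h1 h2 *.
  set c := \int[P]_w df (W n w) in h2 *.
  have -> : r * a - r ^+ 2 * (v * c) = r * (a - r * (v * b)) + r ^+ 2 * (v * (b - c)) by ring.
  apply: le_trans (ler_normD _ _) _; rewrite (normrM r) (normrM (r ^+ 2)) (normrM v) (gtr0_norm r0) (@ger0_norm _ (r ^+ 2)) ?exprn_ge0 ?(ltW r0)//.
  have -> : r ^+ 2 * e = r * (r * M ^+ 2 * eta) + r ^+ 2 * (`|v| * eta).
    by rewrite /eta; field; rewrite gt_eqF.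
  apply: lerD; apply: ler_wpM2l; rewrite ?exprn_ge0 ?(ltW r0)//.
  by rewrite ler_wpM2l.
(* Since [n * r ^+ 2 = 1], the expectation splits into [n] quantities, each controlled by [step]. *)
have -> : \int[P]_w (v * df (W n w) - W n w * f (W n w)) =
  - \sum_(0 <= i < n) (r * \int[P]_w (g (X i w) * f (W n w)) -
      r ^+ 2 * (v * \int[P]_w df (W n w))).
  rewrite big_split/= sumrN big_const_nat subn0 iter_addr_0 -mulr_natl mulrA nr2 mul1r.
  rewrite bexpB; [|exact: bounded_mfunZ (bc _ bdf)|exact: bounded_mfunM (bc _ bf)].
  rewrite bexpZ; last exact: bc.
  rewrite opprB; congr (_ - _).
  rewrite -mulr_sumr -bexp_sum; last by move=> i; apply: bounded_mfunM => //; exact: bc.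
  rewrite -bexpZ; last by apply: bounded_mfun_sum => i; apply: bounded_mfunM => //; exact: bc.
  by apply: eq_Rintegral => w _; rewrite -mulr_suml mulrA.
rewrite normrN; apply: le_trans (ler_norm_sum _ _ _) _.
rewrite (_ : e = \sum_(0 <= i < n) (r ^+ 2 * e)); last first.
  by rewrite big_const_nat subn0 iter_addr_0 -mulr_natl mulrA nr2 mul1r.
by rewrite !big_nat; apply: ler_sum => i /andP[_]; exact: step.
Unshelve. all: end_near. Qed.

End stein.

(** * Derivative rules for real functions *)

Section pointwise_derivatives.
Context {R : realType}.
Implicit Types (f g : R -> R) (x a b c : R).

Lemma derive_fun_cst c x : is_derive x 1 (fun _ : R => c) 0.
Proof. exact: is_derive_cst. Qed.

Lemma derive_fun_id x : is_derive x 1 (fun y : R => y) 1.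
Proof. exact: is_derive_id. Qed.

Lemma derive_funD f g x a b : is_derive x 1 f a -> is_derive x 1 g b ->
  is_derive x 1 (fun y => f y + g y) (a + b).
Proof. by move=> *; exact: is_deriveD. Qed.

Lemma derive_funN f x a : is_derive x 1 f a -> is_derive x 1 (fun y => - f y) (- a).
Proof. by move=> *; exact: is_deriveN. Qed.

Lemma derive_funB f g x a b : is_derive x 1 f a -> is_derive x 1 g b ->
  is_derive x 1 (fun y => f y - g y) (a - b).
Proof. by move=> *; exact: is_deriveB. Qed.

Lemma derive_funM f g x a b : is_derive x 1 f a -> is_derive x 1 g b ->
  is_derive x 1 (fun y => f y * g y) (f x * b + g x * a).
Proof. by move=> *; exact: is_deriveM. Qed.

Lemma derive_funV f x a : f x != 0 -> is_derive x 1 f a ->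
  is_derive x 1 (fun y => (f y)^-1) (- (f x) ^- 2 * a).
Proof. by move=> *; exact: is_deriveV. Qed.

Lemma derive_funX f n x a : is_derive x 1 f a ->
  is_derive x 1 (fun y => f y ^+ n) (n%:R * f x ^+ n.-1 * a).
Proof.
move=> fa; have := @is_deriveX _ _ f n x 1 a fa.
by rewrite (_ : f ^+ n = fun y => f y ^+ n)//; apply/funext => y; rewrite fctE.
Qed.

Lemma derive_fun_comp f g x a b : is_derive (g x) 1 f a -> is_derive x 1 g b ->
  is_derive x 1 (fun y => f (g y)) (a * b).
Proof. exact: is_derive1_comp. Qed.

Lemma derive_continuous f df : (forall x, is_derive x 1 f (df x)) -> continuous f.
Proof.
move=> fdf x; apply: differentiable_continuous; apply/derivable1_diffP.
exact: (@ex_derive _ _ _ _ _ _ _ (fdf x)).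
Qed.

End pointwise_derivatives.

(** * Functions vanishing at infinity *)

Section vanishing.
Context {R : realType}.
Implicit Types F H dH : R -> R.

Definition vanishes F :=
  forall e, 0 < e -> exists B, forall x, B <= `|x| -> `|F x| <= e.

(** Outside a bounded interval [|F|] is at most [1]; inside, the extreme value theorem bounds it. *)
Lemma vanishes_bounded F : continuous F -> vanishes F -> bounded_mfun F.
Proof.
move=> cF vF; split; first exact: continuous_measurable_fun.
have [B hB] := vF 1 ltr01.
have [||c _ hc] := @EVT_max R (fun x => `|F x|) (- `|B|) `|B|.
- by rewrite lerNl (le_trans _ (normr_ge0 B))// oppr_le0.
- by apply: continuous_subspaceT => x; apply: cvg_norm; exact: cF.
exists (`|F c| + 1) => x; have [Bx|xB] := leP `|B| `|x|.
  rewrite (le_trans (hB x _)) ?lerDr//.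
  by rewrite (le_trans (ler_norm B)).
rewrite (le_trans (hc x _)) ?lerDl//.
by rewrite in_itv/= -ler_norml ltW.
Qed.

(** On a compact interval a covering argument gives uniform continuity; farther out both values are
    at most [e / 2] in absolute value. *)
Lemma vanishes_unif_continuous F : continuous F -> vanishes F ->
  forall e, 0 < e -> exists2 del, 0 < del &
    forall x y, `|x - y| < del -> `|F x - F y| <= e.
Proof.
move=> cF vF e e0; have e20 : 0 < e / 2 by rewrite divr_gt0.
have [B hB] := vF _ e20.
have /compact_near_coveringP hc := @segment_compact R (- (`|B| + 1)) (`|B| + 1).
have [|eps /= eps0 heps] := hc R 0^'+
    (fun del x => forall y, `|x - y| < del -> `|F x - F y| <= e) _.
- move=> x xB; have /cvgrPdist_le/(_ _ e20) := cF x; rewrite near_simpl => /nbhs_ballP[r /= r0 hr].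
  exists (ball x (r / 2), [set del | 0 < del < r / 2]) => /=.
    split; first by apply: nbhsx_ballx; rewrite divr_gt0.
    near=> del; apply/andP; split; first by near: del; exact: nbhs_right_gt.
    by near: del; apply: nbhs_right_lt; rewrite divr_gt0.
  move=> [x' del] /= [xx' /andP[del0 delr]] y x'y.
  have h1 : `|F x - F x'| <= e / 2.
    by apply: hr; rewrite /ball/= (lt_trans xx')// ltr_pdivrMr// ltr_pMr// ltr1n.
  have h2 : `|F x - F y| <= e / 2.
    apply: hr; rewrite /ball/= (_ : x - y = (x - x') + (x' - y)); last by ring.
    by rewrite (le_lt_trans (ler_normD _ _))// [ltRHS]splitr ltrD// (lt_trans x'y).
  rewrite (_ : F x' - F y = (F x - F y) - (F x - F x')); last by ring.
  by rewrite (le_trans (ler_normB _ _))// [leRHS]splitr lerD.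
(* The cap [1] matches the margin of the compact interval: when [x] lies outside it, [B <= |y|]
   still holds. *)
- pose del := Num.min (eps / 2) 1.
  have del0 : 0 < del by rewrite lt_min ltr01 andbT divr_gt0.
  have hd : del < eps.
    by rewrite gt_min ltr_pdivrMr// ltr_pMr// ltr1n.
  exists del => // x y xy; have [xB|Bx] := leP `|x| (`|B| + 1).
    apply: (heps del) => //=.
    + by rewrite sub0r normrN gtr0_norm.
    + by rewrite in_itv/= -ler_norml.
  have yB : B <= `|y|.
    have : `|x - y| < 1 by rewrite (lt_le_trans xy)// ge_min lexx orbT.
    have := ler_norm B; have := lerB_dist x y; lra.
  have xB : B <= `|x| by have := ler_norm B; lra.
  by rewrite (le_trans (ler_normB _ _))// [leRHS]splitr lerD// hB.
Unshelve. all: end_near. Qed.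

(** A negative value [H x] would bound [H] from above to the right of [x], which excludes the limit
    [0]. *)
Lemma nonincreasing_to0_ge0 H dH (a : R) :
  (forall x, a < x -> is_derive x 1 H (dH x)) -> (forall x, a < x -> dH x <= 0) ->
  H x @[x --> +oo] --> 0 -> forall x, a < x -> 0 <= H x.
Proof.
move=> hH dH0 H0 x ax; rewrite leNgt; apply/negP => Hx.
have Hx0 : 0 < - H x by rewrite oppr_gt0.
have /cvgrPdist_lt/(_ _ Hx0) nH := H0.
have [y xy] : exists2 y, x < y & `|0 - H y| < - H x.
  have [y [xy Hy]] : exists y, x < y /\ `|0 - H y| < - H x.
    apply: (@filter_ex _ +oo%R).
    by near=> y; split; near: y; [apply: nbhs_pinfty_gt; exact: num_real|exact: nH].
  by exists y.
rewrite sub0r normrN => Hy.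
have [||c] := @MVT R H dH x y xy.
- by move=> z; rewrite in_itv/= => /andP[xz _]; apply: hH; exact: lt_trans xz.
- apply: derivable_within_continuous => z; rewrite in_itv/= => /andP[xz _].
  by apply: (@ex_derive _ _ _ _ _ _ _ (hH z _)); exact: lt_le_trans xz.
rewrite in_itv/= => /andP[xc cy] E.
have : dH c * (y - x) <= 0.
  by apply: mulr_le0_ge0; [apply: dH0; exact: lt_trans xc|rewrite subr_ge0 ltW].
by rewrite -E; have := ler_norm (- H y); rewrite normrN; lra.
Unshelve. all: end_near. Qed.

End vanishing.

(** * Mills' ratio for the normal density *)

Section mills.
Context {R : realType} (s : R).
Hypothesis s0 : 0 < s.
Let p := normal_pdf (0 : R) s.

Lemma normal_pdf_gt0 x : 0 < p x.
Proof.
by rewrite /p normal_pdfE ?gt_eqF// mulr_gt0 ?expR_gt0// normal_peak_gt0 ?gt_eqF.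
Qed.

Lemma is_derive_normal_pdf (x : R) : is_derive x 1 p (- (x / s ^+ 2) * p x).
Proof.
have -> : p = (fun y => normal_peak s * expR (- (y - 0) ^+ 2 / (s ^+ 2 *+ 2))).
  by rewrite /p normal_pdfE ?gt_eqF.
apply: is_derive_eq; rewrite /GRing.scale/=.
by field; rewrite gt_eqF.
Qed.

(* Mills' ratio bounds, obtained by comparing derivatives with those of
   [s^2 p / x] and [s^2 p x / (x^2 + s^2)]. *)
Lemma mills_bounds (G : R -> R) (c a : R) : 0 <= a -> 0 <= c ->
  (forall x, a < x -> is_derive x 1 G (- (c * p x))) ->
  G x @[x --> +oo] --> 0 ->
  forall x, a < x -> c * x / (x ^+ 2 + s ^+ 2) <= G x / (s ^+ 2 * p x) <= c / x.
Proof.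
move=> a0 c0 dG G0.
have pos x : a < x -> 0 < x by exact: le_lt_trans.
have s20 : 0 < s ^+ 2 by rewrite exprn_gt0.
have xs x : 0 < x ^+ 2 + s ^+ 2 by rewrite ltr_wpDl// sqr_ge0.
have sp x : 0 <= s ^+ 2 * p x by rewrite mulr_ge0 ?ltW ?normal_pdf_gt0.
pose U x := s ^+ 2 * p x / x.
pose L x := s ^+ 2 * p x * x / (x ^+ 2 + s ^+ 2).
have cvgU : U x @[x --> +oo] --> 0.
  apply: (@squeeze_cvgr _ _ _ _ (cst 0) (fun x => s ^+ 2 * normal_peak s * x^-1)).
  - near=> x; have x0 : 0 < x by near: x; apply: nbhs_pinfty_gt; exact: num_real.
    rewrite /U (divr_ge0 (sp x) (ltW x0))/=.
    rewrite ler_wpM2r ?invr_ge0 ?(ltW x0)// ler_wpM2l// ?(ltW s20)//.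
    by apply: normal_pdf_ub; rewrite gt_eqF.
  - exact: cvg_cst.
  - rewrite -[X in _ --> X](mulr0 (s ^+ 2 * normal_peak s)); apply: cvgMl_tmp.
    by rewrite gtr0_cvgV0//; near=> x; near: x; apply: nbhs_pinfty_gt; exact: num_real.
have cvgL : L x @[x --> +oo] --> 0.
  apply: (@squeeze_cvgr _ _ _ _ (cst 0) U) => //; last exact: cvg_cst.
  near=> x; have x0 : 0 < x by near: x; apply: nbhs_pinfty_gt; exact: num_real.
  rewrite /U /L (divr_ge0 (mulr_ge0 (sp x) (ltW x0)) (ltW (xs x)))/=.
  rewrite -mulrA ler_wpM2l//.
  rewrite ler_pdivrMr// mulrDr -[x^-1 * _]mulrC expr2 mulfK ?gt_eqF//.
  by rewrite lerDl mulr_ge0// ltW// invr_gt0.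
have dU x : a < x -> is_derive x 1 U (- p x * (1 + s ^+ 2 / x ^+ 2)).
  move=> ax; have x0 := pos _ ax.
  refine (is_derive_eq (derive_funM (derive_funM (derive_fun_cst _ _)
    (is_derive_normal_pdf _)) (derive_funV _ (derive_fun_id _))) _).
    by rewrite gt_eqF.
  by field; rewrite !gt_eqF.
have dL x : a < x -> is_derive x 1 L (- p x * (1 - 2 * s ^+ 4 / (x ^+ 2 + s ^+ 2) ^+ 2)).
  move=> ax; have x0 := pos _ ax.
  refine (is_derive_eq (derive_funM (derive_funM (derive_funM (derive_fun_cst _ _)
    (is_derive_normal_pdf _)) (derive_fun_id _)) (derive_funV _ (derive_funD
    (derive_funX 2 (derive_fun_id _)) (derive_fun_cst _ _)))) _).
    by rewrite gt_eqF.
  by field; rewrite !gt_eqF// ?xs.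
move=> x ax; have x0 := pos _ ax.
have sp0 : 0 < s ^+ 2 * p x by rewrite mulr_gt0 ?normal_pdf_gt0.
have hU : 0 <= c * U x - G x.
  apply: (@nonincreasing_to0_ge0 _ (fun x => c * U x - G x)
     (fun x => c * (- p x * (1 + s ^+ 2 / x ^+ 2)) - - (c * p x)) a) => //.
  - move=> y ay; apply: derive_funB; last exact: dG.
    refine (is_derive_eq (derive_funM (derive_fun_cst _ _) (dU y ay)) _).
    by rewrite mulr0 addr0.
  - move=> y ay; rewrite (_ : _ - _ = - (c * p y * (s ^+ 2 / y ^+ 2))); last by ring.
    by rewrite oppr_le0 mulr_ge0 ?divr_ge0 ?sqr_ge0// mulr_ge0// ltW// normal_pdf_gt0.
  - rewrite -[X in _ --> X](subr0 (0 : R)); apply: cvgB => //.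
    by rewrite -[X in _ --> X](mulr0 c); apply: cvgMl_tmp.
have hL : 0 <= G x - c * L x.
  apply: (@nonincreasing_to0_ge0 _ (fun x => G x - c * L x)
     (fun x => - (c * p x) - c * (- p x * (1 - 2 * s ^+ 4 / (x ^+ 2 + s ^+ 2) ^+ 2))) a) => //.
  - move=> y ay; apply: derive_funB; first exact: dG.
    refine (is_derive_eq (derive_funM (derive_fun_cst _ _) (dL y ay)) _).
    by rewrite mulr0 addr0.
  - move=> y ay; rewrite (_ : _ - _ = - (c * p y * (2 * s ^+ 4 / (y ^+ 2 + s ^+ 2) ^+ 2))); last by ring.
    rewrite oppr_le0 mulr_ge0 ?divr_ge0 ?sqr_ge0//.
      by rewrite mulr_ge0// ltW// normal_pdf_gt0.
    by rewrite mulr_ge0// exprn_even_ge0.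
  - rewrite -[X in _ --> X](subr0 (0 : R)); apply: cvgB => //.
    by rewrite -[X in _ --> X](mulr0 c); apply: cvgMl_tmp.
rewrite ler_pdivlMr// ler_pdivrMr//; apply/andP; split.
- move: hL; rewrite subr_ge0; congr (_ <= _); rewrite /L; ring.
- move: hU; rewrite subr_ge0; congr (_ <= _); rewrite /U; ring.
Unshelve. all: end_near. Qed.

End mills.

(** * Solution of Stein's equation *)

(** For positive [e] this is a continuous function lying between the indicators of the half-lines
    ending at [x] and at [x + e]. *)
Definition ramp {R : realType} (x e y : R) : R :=
  Num.min 1 (Num.max 0 ((x + e - y) / e)).

Section ramp.
Context {R : realType} (x e : R).
Hypothesis e0 : 0 < e.

Lemma ramp_ge0 y : 0 <= ramp x e y.
Proof. by rewrite /ramp le_min ler01 le_max lexx. Qed.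

Lemma ramp_le1 y : ramp x e y <= 1.
Proof. by rewrite /ramp ge_min lexx. Qed.

Lemma ramp_left y : y <= x -> ramp x e y = 1.
Proof.
move=> yx; have h : 1 <= (x + e - y) / e by rewrite ler_pdivlMr// mul1r; lra.
by rewrite /ramp; apply/min_idPl; rewrite le_max h orbT.
Qed.

Lemma ramp_right y : x + e <= y -> ramp x e y = 0.
Proof.
move=> xy; have h : (x + e - y) / e <= 0 by rewrite ler_pdivrMr// mul0r; lra.
by rewrite /ramp (max_idPl h); apply/min_idPr.
Qed.

Lemma continuous_ramp : continuous (ramp x e).
Proof.
move=> y; apply: (@continuous_min _ _ (cst 1) (fun y => Num.max 0 ((x + e - y) / e))).
  exact: cvg_cst.
apply: (@continuous_max _ _ (cst 0) (fun y => (x + e - y) / e)).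
  exact: cvg_cst.
by apply: cvgM; [apply: cvgB; [exact: cvg_cst|exact: cvg_id]|exact: cvg_cst].
Qed.

Lemma bounded_mfun_ramp : bounded_mfun (ramp x e).
Proof.
split; first by apply: continuous_measurable_fun; exact: continuous_ramp.
by exists 1 => y; rewrite ger0_norm ?ramp_ge0 ?ramp_le1.
Qed.

End ramp.

(** * The normal distribution function *)

Section normal_cdf.
Context {R : realType} (s : R).
Local Notation p := (normal_pdf (0 : R) s).
Local Notation mu := (@lebesgue_measure R).

Definition normal_cdf w := \int[mu]_(y in `]-oo, w]) p y.

Let measurable_idR : @measurable_fun _ _ (measurableTypeR R) R setT (fun x => x).
Proof. by move=> _ A mA; rewrite setTI; exact: mA. Qed.

(** The identity is a random variable with the normal law, so general limits of distribution
    functions at infinity carry over to [normal_cdf]. *)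
Let idRV : {RV (normal_prob (0 : R) s) >-> R} :=
  HB.pack (fun x : R => x) (isMeasurableFun.Build _ _ _ _ _ measurable_idR).

Lemma cvg_normal_cdfNy : normal_cdf w @[w --> -oo] --> 0.
Proof. by apply: fine_cvg; exact: (cvg_cdfNy0 idRV). Qed.

Lemma cvg_normal_ccdfy : \int[mu]_(y in `]w, +oo[) p y @[w --> +oo] --> 0.
Proof. by apply: fine_cvg; exact: (cvg_ccdfy0 idRV). Qed.

Hypothesis s0 : 0 < s.

Lemma derive_integral_Ny (k : R -> R) (x : R) : continuous k ->
  mu.-integrable setT (EFin \o k) ->
  is_derive x 1 (fun w => \int[mu]_(y in `]-oo, w]) k y) (k x).
Proof.
move=> ck ik.
have xu : x < x + 1 by rewrite ltrDl.
have ik' : mu.-integrable [set` `]-oo, x + 1]] (EFin \o k).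
  exact: (integrableS measurableT).
have /= := continuous_FTC1 xu ik'; rewrite ltNyr => /(_ isT (ck x)) [h1 h2].
by refine (@DeriveDef _ _ _ _ _ _ _ h1 _); rewrite -derive1E.
Qed.

Lemma continuous_normal_cdf : continuous normal_cdf.
Proof.
apply: (@derive_continuous _ _ p) => x; apply: derive_integral_Ny.
  by apply: continuous_normal_pdf; rewrite gt_eqF.
exact: integrable_normal_pdf.
Qed.

End normal_cdf.

Section stein_solution.
Context {R : realType} (s x e : R).
Hypotheses (s0 : 0 < s) (e0 : 0 < e).
Local Notation p := (normal_pdf (0 : R) s).
Local Notation mu := (@lebesgue_measure R).
Local Notation h := (ramp x e).

Let sN0 : s != 0. Proof. by rewrite gt_eqF. Qed.

Let ip : mu.-integrable setT (EFin \o p).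
Proof. exact: integrable_normal_pdf. Qed.

Let integrable_mulp (k : R -> R) (M : R) : measurable_fun setT k ->
  (forall y, `|k y| <= M) -> mu.-integrable setT (EFin \o (fun y => k y * p y)).
Proof.
move=> mk kM; refine (@le_integrable _ _ R mu setT measurableT (EFin \o (fun y : R => k y * p y))
  (EFin \o (fun y : R => M * p y)) _ _ _).
- by apply/measurable_EFinP; apply: measurable_funM => //; exact: measurable_normal_pdf.
- move=> y _ /=; rewrite lee_fin !normrM ler_pM//.
  by rewrite (le_trans (kM y))// ler_norm.
- have := integrableZl (mu := mu) measurableT M ip.
  by congr (_.-integrable _ _); apply/funext => y /=; rewrite EFinM.
Qed.

Let mh : measurable_fun setT h.
Proof. by have [] := bounded_mfun_ramp x e. Qed.

Definition ramp_normal_mean := \int[mu]_y (h y * p y).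
Local Notation c := ramp_normal_mean.

Let ihp : mu.-integrable setT (EFin \o (fun y => h y * p y)).
Proof.
by apply: (@integrable_mulp _ 1) => // y; rewrite ger0_norm ?ramp_ge0 ?ramp_le1.
Qed.

Lemma ramp_normal_mean_ge : normal_cdf s x <= c.
Proof.
rewrite /normal_cdf Rintegral_mkcond; apply: le_Rintegral => //.
  rewrite -restrict_EFin; apply/integrable_restrict => //; rewrite setTI.
  exact: (integrableS measurableT).
move=> y _; rewrite patchE; case: ifPn => [|_]; last first.
  by rewrite mulr_ge0 ?ramp_ge0 ?normal_pdf_ge0.
by rewrite inE/= in_itv/= => yx; rewrite ramp_left// mul1r.
Qed.

Lemma ramp_normal_mean_le : c <= normal_cdf s (x + e).
Proof.
rewrite /normal_cdf Rintegral_mkcond; apply: le_Rintegral => //.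
  rewrite -restrict_EFin; apply/integrable_restrict => //; rewrite setTI.
  exact: (integrableS measurableT).
move=> y _; rewrite patchE; case: ifPn => [_|].
  by rewrite ler_piMl ?ramp_le1 ?normal_pdf_ge0.
by rewrite notin_setE/= in_itv/= => /negP; rewrite -ltNge => yx; rewrite ramp_right ?mul0r// ltW.
Qed.

Let c01 : 0 <= c <= 1.
Proof.
apply/andP; split.
  by apply: Rintegral_ge0 => y _; rewrite mulr_ge0 ?ramp_ge0 ?normal_pdf_ge0.
have <- : \int[mu]_y p y = 1 by rewrite /Rintegral integral_normal_pdf.
by apply: le_Rintegral => // y _; rewrite ler_piMl ?ramp_le1 ?normal_pdf_ge0.
Qed.

Let k y := (h y - c) * p y.

Let k_le y : `|k y| <= p y.
Proof.
rewrite normrM (ger0_norm (normal_pdf_ge0 _ _ _)) ler_piMl ?normal_pdf_ge0//.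
have := ramp_ge0 x e y; have := ramp_le1 x e y; case/andP: c01 => ? ? ? ?.
by rewrite ler_norml; lra.
Qed.

Let ik : mu.-integrable setT (EFin \o k).
Proof.
refine (@le_integrable _ _ R mu setT measurableT (EFin \o k) (EFin \o p) _ _ ip).
  apply/measurable_EFinP; apply: measurable_funM; last exact: measurable_normal_pdf.
  exact: measurable_funB.
by move=> y _ /=; rewrite lee_fin (le_trans (k_le y))// ler_norm.
Qed.

Let ck : continuous k.
Proof.
move=> y; apply: cvgM; last exact: continuous_normal_pdf.
by apply: cvgB; [exact: continuous_ramp|exact: cvg_cst].
Qed.

Let k0 : \int[mu]_y k y = 0.
Proof.
rewrite /k; under eq_Rintegral do rewrite mulrBl.
rewrite RintegralB//; last by apply: (@integrable_mulp (cst c) `|c|).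
rewrite RintegralZl//.
have -> : \int[mu]_y p y = 1 by rewrite /Rintegral integral_normal_pdf.
by rewrite mulr1 subrr.
Qed.

(** Subtracting [c] gives [k] total integral zero, so [G] is also minus an upper tail integral and
    tends to [0] at both ends. *)
Let G w := \int[mu]_(y in `]-oo, w]) k y.

Let G_ccdf w : G w = - \int[mu]_(y in `]w, +oo[) k y.
Proof.
have /= := @Rintegral_itvB R k -oo%O +oo%O w.
rewrite set_itvE => /(_ ik isT isT); rewrite k0 sub0r => <-.
by rewrite opprK.
Qed.

Let cvgGNy : G w @[w --> -oo] --> 0.
Proof.
apply/norm_cvg0P.
apply: (@squeeze_cvgr _ _ _ _ (cst 0) (normal_cdf s)).
- apply: nearW => w; rewrite normr_ge0/=.
  rewrite (le_trans (le_normr_Rintegral _ _))//.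
    exact: (integrableS measurableT).
  apply: le_Rintegral => //.
  + by apply: (integrableS measurableT) => //; exact: integrable_norm.
  + exact: (integrableS measurableT).
- exact: cvg_cst.
- exact: cvg_normal_cdfNy.
Qed.

Let cvgGy : G w @[w --> +oo] --> 0.
Proof.
rewrite (_ : G = (fun w => - \int[mu]_(y in `]w, +oo[) k y)); last exact/funext/G_ccdf.
rewrite -[X in _ --> X](oppr0 R); apply: (@cvgN _ R^o); apply/norm_cvg0P.
apply: (@squeeze_cvgr _ _ _ _ (cst 0) (fun w => \int[mu]_(y in `]w, +oo[) p y)).
- apply: nearW => w; rewrite normr_ge0/=.
  rewrite (le_trans (le_normr_Rintegral _ _))//.
    exact: (integrableS measurableT).
  apply: le_Rintegral => //.
  + by apply: (integrableS measurableT) => //; exact: integrable_norm.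
  + exact: (integrableS measurableT).
- exact: cvg_cst.
- exact: cvg_normal_ccdfy.
Qed.

Let dG (w : R) : is_derive w 1 G (k w).
Proof. exact: derive_integral_Ny. Qed.

(** As [p' = - (w / s^2) p], Stein's equation reads [(s^2 p f)' = (h - c) p], and integration from
    minus infinity gives [f]. The formula for [df] is read off from the equation. *)
Let f w := G w / (s ^+ 2 * p w).
Let df w := (w * f w + (h w - c)) / s ^+ 2.

Let p_gt0 w : 0 < p w. Proof. exact: (normal_pdf_gt0 s0). Qed.

Let f_derive (w : R) : is_derive w 1 f (df w).
Proof.
refine (is_derive_eq (derive_funM (dG w) (derive_funV _ (derive_funM
  (derive_fun_cst _ _) (is_derive_normal_pdf s0 w)))) _).
  by rewrite gt_eqF// mulr_gt0 ?exprn_gt0.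
by rewrite /df /f /k; field; rewrite sN0 gt_eqF.
Qed.

(** Beyond [x + e] the ramp is [0], so [G' = - c p] and the bounds on Mills' ratio apply with
    constant [c]. *)
Let right_bounds w : Num.max 0 (x + e) < w ->
  c * w / (w ^+ 2 + s ^+ 2) <= f w <= c / w.
Proof.
have a0 : 0 <= Num.max 0 (x + e) by rewrite le_max lexx.
have c0 : 0 <= c by case/andP: c01.
have dG' y : Num.max 0 (x + e) < y -> is_derive y 1 G (- (c * p y)).
  rewrite gt_max => /andP[_ /ltW xy].
  by apply: (is_derive_eq (dG y)); rewrite /k (ramp_right e0 xy) sub0r mulNr.
exact: (mills_bounds s0 a0 c0 dG' cvgGy).
Qed.

(** The reflection [z -> - z] reduces this to the right side: the density is even and the ramp is
    [1] before [x], which turns the constant into [1 - c]. *)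
Let left_bounds w : Num.max 0 (- x) < w ->
  (1 - c) * w / (w ^+ 2 + s ^+ 2) <= f (- w) <= (1 - c) / w.
Proof.
move=> hw.
have pN y : p (- y) = p y by rewrite !normal_pdfE//= /normal_fun !subr0 sqrrN.
have a0 : 0 <= Num.max 0 (- x) by rewrite le_max lexx.
have c0 : 0 <= 1 - c by case/andP: c01; lra.
have dG' y : Num.max 0 (- x) < y ->
    is_derive y 1 (fun z => G (- z)) (- ((1 - c) * p y)).
  rewrite gt_max => /andP[_ xy].
  have yx : - y <= x by lra.
  have dN : is_derive y 1 (fun z : R => - z) (- 1) by exact: derive_funN (derive_fun_id _).
  apply: (is_derive_eq (derive_fun_comp (dG (- y)) dN)).
  by rewrite /k (ramp_left e0 yx) pN mulrN1.
have cG : (fun z => G (- z)) z @[z --> +oo] --> 0 by have /cvgNy_compNP := cvgGNy.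
by have := mills_bounds s0 a0 c0 dG' cG hw; rewrite /f pN.
Qed.

(** The upper bound controls [phi]. The lower one gives [a - w phi <= a s^2 / (w^2 + s^2)], so the
    derivative decays like [1 / w] although [w phi] does not. *)
Let bounds_aux a w phi : 0 <= a <= 1 -> 1 <= w ->
  a * w / (w ^+ 2 + s ^+ 2) <= phi <= a / w ->
  `|phi| <= w^-1 /\ `|(a - w * phi) / s ^+ 2| <= w^-1.
Proof.
move=> /andP[a0 a1] w1 /andP[lo up].
have w0 : 0 < w by lra.
have s20 : 0 < s ^+ 2 by rewrite exprn_gt0.
have ws : 0 < w ^+ 2 + s ^+ 2 by rewrite ltr_wpDl// sqr_ge0.
have lo0 : 0 <= a * w / (w ^+ 2 + s ^+ 2).
  by rewrite divr_ge0 ?(ltW ws)// mulr_ge0// ltW.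
have aw : a / w <= w^-1 by rewrite ler_piMl// invr_ge0 ltW.
split; first by rewrite ger0_norm; lra.
have h1 : w * phi <= a by rewrite mulrC -ler_pdivlMr.
have h2 : w * (a * w / (w ^+ 2 + s ^+ 2)) <= w * phi by rewrite ler_wpM2l// ltW.
rewrite ger0_norm; last by rewrite divr_ge0 ?(ltW s20)// subr_ge0.
rewrite ler_pdivrMr//; apply: (@le_trans _ _ (s ^+ 2 / (w ^+ 2 + s ^+ 2))).
  apply: (@le_trans _ _ (a * (s ^+ 2 / (w ^+ 2 + s ^+ 2)))).
    have E : w * (a * w / (w ^+ 2 + s ^+ 2)) = a - a * (s ^+ 2 / (w ^+ 2 + s ^+ 2)).
      by field; rewrite gt_eqF.
    by rewrite E in h2; lra.
  by rewrite ler_piMl// divr_ge0 ?(ltW ws) ?(ltW s20).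
rewrite mulrC ler_wpM2r ?(ltW s20)// lef_pV2 ?posrE//.
by rewrite expr2; nra.
Qed.

Let B := Num.max (x + e) (Num.max (- x) 0).

Let B_ge : [/\ x + e <= B, - x <= B & 0 <= B].
Proof. by split; rewrite /B !le_max lexx ?orbT. Qed.

(** Past [1 + B] the ramp is constant and [|w|] is at least [1], so [bounds_aux] applies with
    [a = c] on the right and [a = 1 - c] on the left. *)
Let far w : 1 + B <= `|w| -> `|f w| <= `|w|^-1 /\ `|df w| <= `|w|^-1.
Proof.
have [h1 h2 h3] := B_ge => hw.
have [w0|w0] := leP 0 w.
  rewrite (ger0_norm w0) in hw *.
  have hm : Num.max 0 (x + e) < w by rewrite gt_max; apply/andP; split; lra.
  have w1 : 1 <= w by lra.
  have xw : x + e <= w by lra.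
  have [k1 k2] := bounds_aux c01 w1 (right_bounds hm).
  split => //; rewrite /df (ramp_right e0 xw).
  by rewrite (_ : _ / _ = - ((c - w * f w) / s ^+ 2)) ?normrN//; ring.
rewrite (ltr0_norm w0) in hw *.
have hm : Num.max 0 (- x) < - w by rewrite gt_max; apply/andP; split; lra.
have w1 : 1 <= - w by lra.
have xw : w <= x by lra.
have c01' : 0 <= 1 - c <= 1 by case/andP: c01 => ? ?; apply/andP; split; lra.
have := left_bounds hm; rewrite opprK => lb.
have [k1 k2] := bounds_aux c01' w1 lb.
split => //; rewrite /df (ramp_left e0 xw).
by rewrite (_ : _ / _ = (1 - c - - w * f w) / s ^+ 2)//; ring.
Qed.

Let vanishes_far (F : R -> R) :
  (forall w, 1 + B <= `|w| -> `|F w| <= `|w|^-1) -> vanishes F.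
Proof.
move=> hF eps eps0; exists (1 + B + eps^-1) => w hw.
have eV : 0 < eps^-1 by rewrite invr_gt0.
have [_ _ B0] := B_ge.
rewrite (le_trans (hF w _))//; first by lra.
by rewrite -[leRHS]invrK lef_pV2 ?posrE//; lra.
Qed.

(** Both [f] and [df] are continuous and vanish at infinity, which gives boundedness and uniform
    continuity. *)
Lemma stein_solution : exists f df : R -> R, [/\
  forall w : R, is_derive w 1 f (df w), bounded_mfun f, bounded_mfun df,
  forall e, 0 < e -> exists2 del, 0 < del &
     forall x y, `|x - y| < del -> `|df x - df y| <= e &
  forall w, s ^+ 2 * df w - w * f w = h w - c].
Proof.
have cf : continuous f := derive_continuous f_derive.
have cdf : continuous df.
  move=> w; apply: cvgM; last exact: cvg_cst.
  apply: cvgD; first by apply: cvgM; [exact: cvg_id|exact: cf].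
  by apply: cvgB; [exact: continuous_ramp|exact: cvg_cst].
have vf : vanishes f by apply: vanishes_far => w /far[].
have vdf : vanishes df by apply: vanishes_far => w /far[].
exists f, df; split => //.
- exact: vanishes_bounded.
- exact: vanishes_bounded.
- exact: vanishes_unif_continuous.
- by move=> w; rewrite /df; field.
Qed.

End stein_solution.

(** * Central limit theorem *)

Section clt.
Context {d} {T : measurableType d} {R : realType} (P : probability T R).
Variable X : nat -> {RV P >-> R}.
Hypothesis hind : mutually_independent X.
Hypothesis hid : forall i (A : set R), measurable A ->
  P (X i @^-1` A) = P (X 0%N @^-1` A).
Let mu := distribution P (X 0%N).
Variables (g : R -> R) (s : R).
Hypothesis s0 : 0 < s.
Hypothesis bg : bounded_mfun g.
Hypothesis g0 : \int[mu]_x g x = 0.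
Hypothesis gs : \int[mu]_x (g x) ^+ 2 = s ^+ 2.
Local Notation W := (normalized_sum X g).

(** By Stein's equation the difference between the mean of the ramp at [W n] and its normal mean is
    the expectation shown to vanish by [stein_identity]. *)
Let cvg_ramp x e : 0 < e ->
  \int[P]_w ramp x e (W n w) @[n --> \oo] --> ramp_normal_mean s x e.
Proof.
move=> e0; have [f [df [fdf bf bdf ucdf E]]] := stein_solution x s0 e0.
have h := stein_identity hind hid bg g0 gs fdf bf bdf ucdf.
rewrite -[X in _ --> X]add0r.
have -> : (fun n => \int[P]_w ramp x e (W n w)) = (fun n =>
    \int[P]_w (s ^+ 2 * df (W n w) - W n w * f (W n w)) + ramp_normal_mean s x e).
  apply/funext => n; under [in RHS]eq_Rintegral do rewrite E.
  rewrite bexpB ?bexp_cst ?subrK//; last exact: bounded_mfun_cst.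
  apply: (bounded_mfun_comp (bounded_mfun_ramp x e)).
  exact: (bounded_normalized_sum X bg n).1.
by apply: cvgD => //; exact: cvg_cst.
Qed.

Let mW n x : measurable [set w | W n w <= x].
Proof.
rewrite (_ : [set _ | _] = W n @^-1` `]-oo, x]); last first.
  by apply/seteqP; split => w /=; rewrite in_itv.
rewrite -[X in measurable X]setTI.
exact: (bounded_normalized_sum X bg n).1.
Qed.

Let bW n x e : bounded_mfun (fun w => ramp x e (W n w)).
Proof.
apply: (bounded_mfun_comp (bounded_mfun_ramp x e)).
exact: (bounded_normalized_sum X bg n).1.
Qed.

(** The indicator of [W n <= x] lies between the ramps starting at [x - e] and at [x]; the limits of
    their means lie between [normal_cdf] at [x - e] and at [x + e], which are close by
    continuity. *)
Lemma central_limit x :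
  fine (P [set w | W n w <= x]) @[n --> \oo] --> normal_cdf s x.
Proof.
apply/cvgrPdist_le => /= eps eps0.
have eps20 : 0 < eps / 2 by rewrite divr_gt0.
have /cvgrPdist_le/(_ _ eps20) := @continuous_normal_cdf R s s0 x.
rewrite near_simpl => /nbhs_ballP[r /= r0 hr].
pose e := r / 2; have e0 : 0 < e by rewrite divr_gt0.
have er : e < r by rewrite /e ltr_pdivrMr// ltr_pMr// ltr1n.
have hp : `|normal_cdf s x - normal_cdf s (x + e)| <= eps / 2.
  by apply: hr; rewrite /ball/= opprD addNKr normrN gtr0_norm.
have hm : `|normal_cdf s x - normal_cdf s (x - e)| <= eps / 2.
  by apply: hr; rewrite /ball/= subKr gtr0_norm.
have /cvgrPdist_le/(_ _ eps20) c1 := @cvg_ramp x e e0.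
have /cvgrPdist_le/(_ _ eps20) c2 := @cvg_ramp (x - e) e e0.
near=> n.
have d1 : `|ramp_normal_mean s x e - \int[P]_w ramp x e (W n w)| <= eps / 2 by near: n.
have d2 : `|ramp_normal_mean s (x - e) e - \int[P]_w ramp (x - e) e (W n w)| <= eps / 2 by near: n.
have b1 := ramp_normal_mean_le s x e0.
have b2 := ramp_normal_mean_ge s (x - e) e0.
have bi : bounded_mfun (\1_[set w | W n w <= x] : T -> R) by apply: bounded_mfun_indic; exact: mW.
have u1 : fine (P [set w | W n w <= x]) <= \int[P]_w ramp x e (W n w).
  rewrite -bexp_indic; last exact: mW.
  apply: le_bexp => // w; rewrite indicE; case: (boolP (w \in _)) => [|_]; last exact: ramp_ge0.
  by rewrite inE/= => wx; rewrite ramp_left.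
have u2 : \int[P]_w ramp (x - e) e (W n w) <= fine (P [set w | W n w <= x]).
  rewrite -bexp_indic; last exact: mW.
  apply: le_bexp => // w; rewrite indicE; case: (boolP (w \in _)) => [_|]; first exact: ramp_le1.
  rewrite notin_setE/= => /negP; rewrite -ltNge => xw.
  by rewrite ramp_right// subrK ltW.
move: hp hm d1 d2; rewrite !ler_norml => /andP[? ?] /andP[? ?] /andP[? ?] /andP[? ?].
by apply/andP; split; lra.
Unshelve. all: end_near. Qed.

End clt.

(** * Laws with a density *)

Section density.
Context {d} {T : measurableType d} {R : realType} (P : probability T R).
Variables (X : {RV P >-> R}) (f : R -> R).
Local Notation leb := (@lebesgue_measure R).
Hypothesis mf : measurable_fun setT f.
Hypothesis f0 : forall x, 0 <= f x.
Hypothesis Pf : forall A, measurable A ->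
  P (X @^-1` A) = (\int[leb]_(x in A) (f x)%:E)%E.

Lemma integrable_density : leb.-integrable setT (EFin \o f).
Proof.
apply/integrableP; split; first exact/measurable_EFinP.
under eq_integral do rewrite /= ger0_norm//.
rewrite -Pf// (le_lt_trans (probability_le1 _ _)) ?ltry//.
by rewrite -[X in measurable X]setTI; exact: measurable_funP.
Qed.

Lemma integrable_density_mul (g : R -> R) : bounded_mfun g ->
  leb.-integrable setT (EFin \o (fun x => g x * f x)).
Proof.
move=> [mg [M hM]].
refine (@le_integrable _ _ R leb setT measurableT (EFin \o (fun x : R => g x * f x))
  (EFin \o (fun x : R => M * f x)) _ _ _).
- by apply/measurable_EFinP; exact: measurable_funM.
- move=> y _ /=; rewrite lee_fin !normrM ler_pM//.
  by rewrite (le_trans (hM y))// ler_norm.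
- have := integrableZl (mu := leb) measurableT M integrable_density.
  by congr (_.-integrable _ _); apply/funext => y /=; rewrite EFinM.
Qed.

(* The law is viewed on [measurableTypeR R], the carrier of Lebesgue measure. *)
Let mX : @measurable_fun _ _ T (measurableTypeR R) setT X.
Proof. by move=> _ A mA; exact: (measurable_funP X). Qed.

Let XL : {mfun T >-> measurableTypeR R} :=
  HB.pack (X : T -> measurableTypeR R) (isMeasurableFun.Build _ _ _ _ _ mX).

(** The law and the density agree on sets, so [f] is almost everywhere the Radon-Nikodym derivative
    of the law; a change of variables extends the equality to [g]. *)
Lemma bexp_density (g : R -> R) : bounded_mfun g ->
  \int[P]_w g (X w) = \int[leb]_x (g x * f x).
Proof.
move=> bg; pose nu := distribution P XL.
have bg' : @bounded_mfun _ (measurableTypeR R) R g.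
  by case: bg => mg [M hM]; split; [exact: mg|exists M].
have nuf A : measurable A -> nu A = (\int[leb]_(x in A) (f x)%:E)%E by exact: Pf.
have nuleb : nu `<< leb.
  apply/null_content_dominatesP => A mA A0; rewrite nuf//.
  by apply: null_set_integral => //; apply/measurable_EFinP; exact: measurable_funTS.
have mRN := Radon_Nikodym_integrable (nu := charge_of_finite_measure nu) nuleb.
rewrite (bexp_distribution XL bg') /Rintegral; congr fine.
have ig := bounded_mfun_integrable nu bg'.
have mEg := measurable_int _ ig.
have mEf := measurable_int _ integrable_density.
have mERN := measurable_int _ mRN.
rewrite -(Radon_Nikodym_change_of_variables nuleb measurableT ig).
under [RHS]eq_integral do rewrite EFinM.
apply: ae_eq_integral => //.
- exact: emeasurable_funM.
- exact: emeasurable_funM.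
apply: ae_eqe_mul2l; apply: integral_ae_eq => //.
by move=> E _ mE; rewrite -Radon_Nikodym_integral// -nuf.
Qed.

End density.

(** * Integral of a derivative over the line *)

Section integral_of_derivative.
Context {R : realType}.
Local Notation leb := (@lebesgue_measure R).

(** On growing symmetric intervals the fundamental theorem gives boundary values tending to [0];
    dominated convergence, with [|f|] as dominating function, passes to the line. *)
Lemma Rintegral_derivative0 (F f : R -> R) :
  (forall x : R, is_derive x 1 F (f x)) -> continuous f ->
  leb.-integrable setT (EFin \o f) ->
  F x @[x --> +oo] --> 0 -> F x @[x --> -oo] --> 0 ->
  \int[leb]_x f x = 0.
Proof.
move=> Ff cf intf Fy FNy.
(* The successor keeps the interval nondegenerate at [n = 0]. *)
pose D (n : nat) : set R := `[- n.+1%:R, n.+1%:R]%classic.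
have mD n : measurable (D n) by exact: measurable_itv.
pose f_ (n : nat) := (EFin \o f) \_ (D n).
have mf : measurable_fun setT f by exact: continuous_measurable_fun.
have [] := @dominated_convergence _ _ R leb setT measurableT f_ (EFin \o f) (abse \o (EFin \o f)).
- move=> n; apply/(measurable_restrictT _ (mD n)).
  by apply: measurable_funTS; exact/measurable_EFinP.
- exact/measurable_EFinP.
- apply: aeW => x _; apply: cvg_near_cst; near=> n.
  rewrite /f_ patchE mem_set// /D/= in_itv/= -ler_norml.
  have xn : `|x| < n%:R by near: n; exact: nbhs_infty_gtr.
  by rewrite (le_trans (ltW xn))// ler_nat.
- exact: integrable_abse.
- apply: aeW => x n _; rewrite /f_ patchE; case: ifPn => // _.
  by rewrite abse0 abse_ge0.
move=> _ _ cvgf.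
suff : (\int[leb]_x f_ n x)%E @[n --> \oo] --> 0%E.
  by move=> h; have := cvg_unique _ cvgf h; rewrite /Rintegral => ->.
have FTC n : (\int[leb]_x f_ n x)%E = (F n.+1%:R - F (- n.+1%:R))%:E.
  rewrite /f_ -integral_mkcond EFinB (@continuous_FTC2 _ f F)//.
  - by rewrite gtrN.
  - exact: continuous_subspaceT.
  - have cF : continuous F := derive_continuous Ff.
    split.
    + by move=> x _; exact: (@ex_derive _ _ _ _ _ _ _ (Ff x)).
    + by apply: cvg_at_right_filter; exact: cF.
    + by apply: cvg_at_left_filter; exact: cF.
  - by move=> x _; rewrite derive1E; exact: derive_val.
under eq_cvg do rewrite FTC.
apply: cvg_EFin; first exact: nearW.
have nSy : (n.+1%:R : R) @[n --> \oo] --> +oo%R.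
  by rewrite (cvg_shiftS (fun n => n%:R : R)); exact: cvgr_idn.
rewrite -[X in _ --> X](subr0 (0 : R)); apply: cvgB.
  exact: (cvg_comp _ _ nSy Fy).
move/cvgNy_compNP : FNy => FNy.
exact: (cvg_comp _ _ nSy FNy).
Unshelve. all: end_near. Qed.

End integral_of_derivative.

(** * Moments of the Pearson VII law *)

Section vanishing_limits.
Context {R : realType}.
Implicit Types F G : R -> R.

Lemma vanishes_cvgy F : vanishes F -> F x @[x --> +oo] --> 0.
Proof.
move=> vF; apply/cvgrPdist_le => e e0; have [B hB] := vF _ e0.
near=> x; rewrite sub0r normrN; apply: hB.
by apply: le_trans (ler_norm x); near: x; apply: nbhs_pinfty_ge; exact: num_real.
Unshelve. all: end_near. Qed.

Lemma vanishes_opp F : vanishes F -> vanishes (fun x => F (- x)).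
Proof.
by move=> vF e /vF[B hB]; exists B => x Bx; apply: hB; rewrite normrN.
Qed.

Lemma vanishes_cvgNy F : vanishes F -> F x @[x --> -oo] --> 0.
Proof. by move=> /vanishes_opp/vanishes_cvgy vF; apply/cvgNy_compNP. Qed.

Lemma vanishes_shift F a : vanishes F -> vanishes (fun x => F (x - a)).
Proof.
move=> vF e /vF[B hB]; exists (B + `|a|) => x Bx; apply: hB.
by have := lerB_dist x a; lra.
Qed.

Lemma vanishes_le F G : (forall x, `|F x| <= `|G x|) -> vanishes G -> vanishes F.
Proof.
by move=> FG vG e /vG[B hB]; exists B => x /hB; exact: le_trans.
Qed.

End vanishing_limits.

(** * The score function and its derivatives *)

(** [psi] is the derivative of [ln (1 + y^2)], so [- m * psi] is the logarithmic derivative of the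
    density; [dpsi] is the derivative of [psi]. *)
Definition psi {R : realType} (y : R) : R := 2 * y / (1 + y ^+ 2).
Definition dpsi {R : realType} (y : R) : R := 2 * (1 - y ^+ 2) / (1 + y ^+ 2) ^+ 2.

Section cauchy_weight.
Context {R : realType}.
Implicit Types y : R.

Lemma one_sqr_gt0 y : 0 < 1 + y ^+ 2.
Proof. by rewrite ltr_pwDl// sqr_ge0. Qed.

Lemma one_sqr_neq0 y : 1 + y ^+ 2 != 0.
Proof. by rewrite gt_eqF// one_sqr_gt0. Qed.

Lemma derive_one_sqr y : is_derive y 1 (fun z : R => 1 + z ^+ 2) (2 * y).
Proof.
refine (is_derive_eq (derive_funD (derive_fun_cst _ _) (derive_funX 2 (derive_fun_id _))) _).
by rewrite /= expr1 add0r mulr1.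
Qed.

Lemma derive_inv_one_sqr y :
  is_derive y 1 (fun z : R => (1 + z ^+ 2)^-1) (- (2 * y) / (1 + y ^+ 2) ^+ 2).
Proof.
refine (is_derive_eq (derive_funV (f := fun z => 1 + z ^+ 2)
  (one_sqr_neq0 y) (derive_one_sqr y)) _).
by field; rewrite one_sqr_neq0.
Qed.

Lemma derive_psi y : is_derive y 1 psi (dpsi y).
Proof.
refine (is_derive_eq (derive_funM (derive_funM (derive_fun_cst _ _)
  (derive_fun_id _)) (derive_inv_one_sqr y)) _).
by rewrite /dpsi; field; rewrite one_sqr_neq0.
Qed.

Lemma derive_dpsi y : is_derive y 1 dpsi
  (4 * y * (y ^+ 2 - 3) / (1 + y ^+ 2) ^+ 3).
Proof.
refine (is_derive_eq (derive_funM (derive_funM (derive_fun_cst _ _)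
  (derive_funB (derive_fun_cst _ _) (derive_funX 2 (derive_fun_id _))))
  (derive_funV (f := fun z => (1 + z ^+ 2) ^+ 2) _
    (derive_funX (f := fun z => 1 + z ^+ 2) 2 (derive_one_sqr y)))) _).
  by rewrite expf_neq0// one_sqr_neq0.
by rewrite /=; field; rewrite one_sqr_neq0.
Qed.

Lemma derive_ln_one_sqr y : is_derive y 1 (fun z : R => ln (1 + z ^+ 2)) (psi y).
Proof.
refine (is_derive_eq (derive_fun_comp (f := @ln R) (g := fun z => 1 + z ^+ 2)
  (is_derive1_ln (one_sqr_gt0 y)) (derive_one_sqr y)) _).
by rewrite /psi mulrC.
Qed.

Lemma psi_le1 y : `|psi y| <= 1.
Proof.
rewrite /psi normrM normfV (gtr0_norm (one_sqr_gt0 y)) ler_pdivrMr ?one_sqr_gt0// mul1r.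
have h1 := sqr_ge0 (1 + y); have h2 := sqr_ge0 (1 - y).
by rewrite ler_norml; apply/andP; split; nra.
Qed.

Lemma dpsi_le2 y : `|dpsi y| <= 2.
Proof.
have w0 := one_sqr_gt0 y.
rewrite /dpsi normrM normfV (gtr0_norm (exprn_gt0 2 w0)) ler_pdivrMr ?exprn_gt0//.
by rewrite ler_norml; apply/andP; split; have := sqr_ge0 y; nra.
Qed.

Lemma ddpsi_le y : `|4 * y * (y ^+ 2 - 3) / (1 + y ^+ 2) ^+ 3| <= 6.
Proof.
have w0 := one_sqr_gt0 y; have y2 := sqr_ge0 y.
rewrite normrM normfV (gtr0_norm (exprn_gt0 3 w0)) ler_pdivrMr ?exprn_gt0//.
(* The factors [4 |y|] and [|y^2 - 3|] are bounded separately, by [2 (1 + y^2)] and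
   [3 (1 + y^2)^2]. *)
rewrite normrM; apply: (@le_trans _ _ ((2 * (1 + y ^+ 2)) * (3 * (1 + y ^+ 2) ^+ 2))).
  apply: ler_pM => //.
    have h1 := sqr_ge0 (1 + y); have h2 := sqr_ge0 (1 - y).
    by rewrite ler_norml; apply/andP; split; nra.
  by rewrite ler_norml; apply/andP; split; nra.
by rewrite le_eqVlt; apply/orP; left; apply/eqP; ring.
Qed.

Lemma lipschitz_derive_bound (f df : R -> R) (M : R) :
  (forall x : R, is_derive x 1 f (df x)) -> (forall x, `|df x| <= M) ->
  forall x y, `|f x - f y| <= M * `|x - y|.
Proof.
move=> fdf dfM x y; have cf := derive_continuous fdf.
have mvt (a b : R) : a < b -> `|f b - f a| <= M * `|b - a|.
  move=> ab; have [|c _ ->] := @MVT R f df a b ab (fun x _ => fdf x).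
    exact: continuous_subspaceT.
  by rewrite normrM ler_wpM2r.
have [xy|yx|->] := ltgtP x y; last by rewrite !subrr normr0 mulr0.
  by rewrite distrC (distrC x); exact: mvt.
exact: mvt.
Qed.

End cauchy_weight.

Section pvii_moments.
Context {d} {T : measurableType d} {R : realType} (P : probability T R).
Variables (X : {RV P >-> R}) (m theta : R).
Hypotheses (hm : 2^-1 < m) (hlaw : has_law_pvii X m theta).
Local Notation leb := (@lebesgue_measure R).
Let q (y : R) := pvii_f m y.

Let derive_q (y : R) : is_derive y 1 q (- (m * psi y) * q y).
Proof.
have w0 := one_sqr_gt0 y.
refine (is_derive_eq (derive_funM (derive_fun_cst _ _)
  (derive_fun_comp (f := (@powR R)^~ (- m)) (g := fun z => 1 + z ^+ 2)
    (is_derive1_powR (- m) w0) (derive_one_sqr y))) _).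
rewrite mulr0 addr0 /q /pvii_f /psi powRB; last by rewrite one_sqr_neq0 implybT.
by rewrite powRr1 ?(ltW w0)//; field; rewrite one_sqr_neq0.
Qed.

Let continuous_q : continuous q := derive_continuous derive_q.

Lemma pvii_c_ge0 : 0 <= pvii_c m.
Proof.
rewrite /pvii_c invr_ge0 fine_ge0//; apply: integral_ge0 => x _.
by rewrite lee_fin powR_ge0.
Qed.

(** The defining formula would yield [0] for an infinite integral. A random variable with this law
    excludes that: the density would be zero and the total mass [0] instead of [1]. *)
Lemma pvii_c_gt0 : 0 < pvii_c m.
Proof.
rewrite lt_neqAle pvii_c_ge0 andbT eq_sym; apply/eqP => c0.
have := hlaw measurableT; rewrite preimage_setT.
under eq_integral do rewrite /pvii_f c0 mul0r.
rewrite integral0 => h; have /eqP := etrans (esym h) (probability_setT P).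
by rewrite eqe eq_sym oner_eq0.
Qed.

Lemma pvii_f_gt0 y : 0 < q y.
Proof. by rewrite /q /pvii_f mulr_gt0 ?pvii_c_gt0// powR_gt0// one_sqr_gt0. Qed.

Let qX (x : R) := q (x - theta).

Let mqX : measurable_fun setT qX.
Proof.
apply: continuous_measurable_fun => x.
apply: (@continuous_comp _ _ _ (fun x => x - theta) q); last exact: continuous_q.
by apply: cvgB; [exact: cvg_id|exact: cvg_cst].
Qed.

Let qX0 x : 0 <= qX x. Proof. exact/ltW/pvii_f_gt0. Qed.

(** As [|y| <= (1 + y^2)^(1/2)], the product is at most a constant times [(1 + y^2)^(- r)], where
    [r = m - 1/2] is positive. *)
Lemma vanishes_mul_pvii_f : vanishes (fun y => y * q y).
Proof.
have r0 : 0 < m - 2^-1 by rewrite subr_gt0.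
set r := m - 2^-1 in r0.
move=> e e0; have c0 := pvii_c_gt0.
have ec0 : 0 < e / pvii_c m by rewrite divr_gt0.
set E := e / pvii_c m in ec0.
(* The power solves [(1 + y^2)^r >= E^-1]; the added [1] forces [|y| >= 1], hence [y^2 >= |y|]. *)
exists (1 + E^-1 `^ r^-1) => y hy.
have w0 := one_sqr_gt0 y.
have p0 : 0 <= E^-1 `^ r^-1 by rewrite powR_ge0.
have yw : E^-1 `^ r^-1 <= 1 + y ^+ 2.
  have : `|y| ^+ 2 = y ^+ 2 by rewrite real_normK ?num_real.
  by have := normr_ge0 y; nra.
have hw : E^-1 <= (1 + y ^+ 2) `^ r.
  have := ge0_ler_powR (ltW r0) _ _ yw.
  rewrite -powRrM mulVf ?gt_eqF// powRr1 ?invr_ge0 ?(ltW ec0)//; apply.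
    by rewrite nnegrE.
  by rewrite nnegrE ltW.
have yroot : `|y| <= (1 + y ^+ 2) `^ 2^-1.
  by rewrite powR12_sqrt ?(ltW w0)// -sqrtr_sqr ler_wsqrtr// lerDr.
rewrite /q /pvii_f !normrM (gtr0_norm c0) (ger0_norm (powR_ge0 _ _)).
have wm : (1 + y ^+ 2) `^ (- m) = ((1 + y ^+ 2) `^ 2^-1)^-1 * ((1 + y ^+ 2) `^ r)^-1.
  by rewrite -invfM -powRD ?one_sqr_neq0 ?implybT// -powRN; congr (_ `^ _); rewrite /r; ring.
have A0 : 0 < (1 + y ^+ 2) `^ 2^-1 by rewrite powR_gt0.
have B0 : 0 < (1 + y ^+ 2) `^ r by rewrite powR_gt0.
rewrite wm; set A := _ `^ 2^-1 in A0 yroot *; set B := _ `^ r in B0 hw *.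
rewrite (_ : _ * _ = (`|y| / A) * (pvii_c m / B)); last by field; rewrite !gt_eqF.
rewrite -[leRHS]mul1r ler_pM ?divr_ge0 ?(ltW A0) ?(ltW B0) ?(ltW c0)//.
  by rewrite ler_pdivrMr// mul1r.
rewrite ler_pdivrMr// -ler_pdivrMl// mulrC.
by move: hw; rewrite /E invf_div.
Qed.

Let vanishes_q : vanishes q.
Proof.
move=> e e0; have [B hB] := vanishes_mul_pvii_f e0.
exists (Num.max B 1) => y; rewrite ge_max => /andP[yB y1].
by apply: le_trans (hB _ yB); rewrite (normrM y) ler_peMl.
Qed.

Lemma bounded_mfun_shift (g : R -> R) (M : R) : continuous g ->
  (forall y, `|g y| <= M) -> bounded_mfun (fun x : R => g (x - theta)).
Proof.
move=> cg gM; split; last by exists M.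
apply: continuous_measurable_fun => x.
apply: (@continuous_comp _ _ _ (fun x => x - theta) g); last exact: cg.
by apply: cvgB; [exact: cvg_id|exact: cvg_cst].
Qed.

Lemma bounded_mfun_RV_shift (g : R -> R) (M : R) : continuous g ->
  (forall y, `|g y| <= M) -> bounded_mfun (fun w => g (X w - theta)).
Proof.
move=> cg gM.
exact: (@bounded_mfun_comp _ _ _ _ _ (fun x : R => g (x - theta)) X
  (bounded_mfun_shift cg gM)).
Qed.

Lemma bexp_pvii (g : R -> R) (M : R) : continuous g -> (forall y, `|g y| <= M) ->
  \int[P]_w g (X w - theta) = \int[leb]_x (g (x - theta) * qX x).
Proof. by move=> cg gM; apply: (bexp_density mqX qX0 hlaw); exact: bounded_mfun_shift gM. Qed.

(** Each moment below comes from a choice of [F]: the density for [mean_psi], then [y q] for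
    [mean_u] and [y q / (1 + y^2)] for [mean_u2]. *)
Let bexp_derivative0 (F g : R -> R) (M : R) : continuous g ->
  (forall y, `|g y| <= M) -> (forall y : R, is_derive y 1 F (g y * q y)) ->
  vanishes F -> \int[P]_w g (X w - theta) = 0.
Proof.
move=> cg gM dF vF; rewrite (bexp_pvii cg gM).
have vF' := @vanishes_shift _ F theta vF.
apply: (@Rintegral_derivative0 _ (fun x => F (x - theta))).
- move=> x; have dB : is_derive x 1 (fun y : R => y - theta) 1.
    by refine (is_derive_eq (derive_funB (derive_fun_id _) (derive_fun_cst _ _)) _); rewrite subr0.
  by refine (is_derive_eq (derive_fun_comp (f := F) (g := fun y => y - theta) (dF _) dB) _); rewrite mulr1.
- move=> x; apply: (@continuous_comp _ _ _ (fun x => x - theta) (fun y => g y * q y)).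
    by apply: cvgB; [exact: cvg_id|exact: cvg_cst].
  by apply: cvgM; [exact: cg|exact: continuous_q].
- by apply: (integrable_density_mul mqX qX0 hlaw); exact: bounded_mfun_shift gM.
- exact: vanishes_cvgy.
- exact: vanishes_cvgNy.
Qed.

Let u (y : R) := (1 + y ^+ 2)^-1.

Let cu : continuous u := derive_continuous derive_inv_one_sqr.

Let u01 y : 0 < u y <= 1.
Proof.
by rewrite /u invr_gt0 one_sqr_gt0 invf_le1 ?one_sqr_gt0// lerDl sqr_ge0.
Qed.

Let u_le1 y : `|u y| <= 1.
Proof. by case/andP: (u01 y) => u0 u1; rewrite gtr0_norm. Qed.

Let u2_le1 y : `|u y ^+ 2| <= 1.
Proof. by rewrite normrX expr_le1. Qed.

Let cu2 : continuous (fun y => u y ^+ 2).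
Proof. by move=> y; apply: cvgM; exact: cu. Qed.

Let m0 : 0 < m. Proof. by apply: lt_trans hm; rewrite invr_gt0. Qed.

Lemma mean_psi : \int[P]_w psi (X w - theta) = 0.
Proof.
have cpsi : continuous (fun y : R => - m * psi y).
  by move=> y; apply: cvgMl_tmp; exact: derive_continuous derive_psi y.
have bpsi y : `|- m * psi y| <= m.
  by rewrite normrM normrN (gtr0_norm m0) ler_piMr ?psi_le1 ?ltW.
have /= := bexp_derivative0 cpsi bpsi _ vanishes_q.
have bP : bounded_mfun (fun w => psi (X w - theta)).
  by apply: bounded_mfun_RV_shift psi_le1; exact: derive_continuous derive_psi.
rewrite bexpZ// => h.
have /eqP : - m * \int[P]_w psi (X w - theta) = 0.
  by apply: h => y; apply: (is_derive_eq (derive_q y)); ring.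
by rewrite mulf_eq0 oppr_eq0 gt_eqF//= => /eqP.
Qed.

Let bu : bounded_mfun (fun w => u (X w - theta)).
Proof. exact: bounded_mfun_RV_shift u_le1. Qed.

Let bu2 : bounded_mfun (fun w => u (X w - theta) ^+ 2).
Proof. exact: (bounded_mfunM bu bu). Qed.

Let mean_u : \int[P]_w u (X w - theta) = (2 * m - 1) / (2 * m).
Proof.
pose g y := (1 - 2 * m) + 2 * m * u y.
have cg : continuous g.
  by move=> y; apply: cvgD; [exact: cvg_cst|apply: cvgMl_tmp; exact: cu].
have gM (y : R) : `|g y| <= `|1 - 2 * m| + 2 * m.
  rewrite (le_trans (ler_normD _ _))// lerD2l normrM ger0_norm ?mulr_ge0 ?(ltW m0)//.
  by rewrite ler_piMr// mulr_ge0// ltW.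
have dF (y : R) : is_derive y 1 (fun z => z * q z) (g y * q y).
  refine (is_derive_eq (derive_funM (derive_fun_id _) (derive_q y)) _).
  by rewrite /g /u /psi; field; rewrite one_sqr_neq0.
have := bexp_derivative0 cg gM dF vanishes_mul_pvii_f.
rewrite /g bexpD; [|exact: bounded_mfun_cst|exact: bounded_mfunZ].
rewrite bexp_cst bexpZ// => h; apply: (mulfI (_ : 2 * m != 0)).
  by rewrite gt_eqF// mulr_gt0.
by rewrite mulrCA divff ?mulr1 ?gt_eqF ?mulr_gt0//; lra.
Qed.

Let mean_u2 : \int[P]_w u (X w - theta) ^+ 2 =
  (2 * m - 1) / (2 * m) * ((2 * m + 1) / (2 * m + 2)).
Proof.
pose g y := - (1 + 2 * m) * u y + (2 + 2 * m) * u y ^+ 2.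
have cg : continuous g.
  by move=> y; apply: cvgD; [apply: cvgMl_tmp; exact: cu|apply: cvgMl_tmp; exact: cu2].
have gM (y : R) : `|g y| <= `|- (1 + 2 * m)| + `|2 + 2 * m|.
  by rewrite (le_trans (ler_normD _ _))//; apply: lerD; rewrite normrM ler_piMr.
have dF (y : R) : is_derive y 1 (fun z => z * q z * u z) (g y * q y).
  refine (is_derive_eq (derive_funM (derive_funM (derive_fun_id _) (derive_q y))
    (derive_inv_one_sqr y)) _).
  by rewrite /g /u /psi; field; rewrite one_sqr_neq0.
have vF : vanishes (fun z => z * q z * u z).
  apply: (vanishes_le _ vanishes_mul_pvii_f) => y.
  by rewrite normrM ler_piMr.
have := bexp_derivative0 cg gM dF vF.
rewrite /g bexpD; [|exact: bounded_mfunZ|exact: bounded_mfunZ].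
rewrite !bexpZ// mean_u => h.
have m20 : 2 * m + 2 != 0 by rewrite gt_eqF//; have := m0; lra.
apply: (mulfI m20); move: h; set a := _ / _; set b := Rintegral _ _ _ => h.
have -> : (2 * m + 2) * b = (1 + 2 * m) * a.
  by apply/eqP; rewrite -subr_eq0 -h; apply/eqP; ring.
by field.
Qed.

(** Here [psi^2 = 4 u - 4 u^2], so the first two moments of [u] suffice. *)
Lemma mean_psi_sqr : \int[P]_w psi (X w - theta) ^+ 2 = (2 * m - 1) / (m * (m + 1)).
Proof.
rewrite (_ : (fun w => _) = (fun w => 4 * u (X w - theta) - 4 * u (X w - theta) ^+ 2)); last first.
  by apply/funext => w; rewrite /psi /u; field; rewrite one_sqr_neq0.
rewrite bexpB; [|exact: bounded_mfunZ|exact: bounded_mfunZ].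
rewrite !bexpZ// mean_u mean_u2; field.
by rewrite !gt_eqF//; have := m0; lra.
Qed.

(** Here [dpsi = 4 u^2 - 2 u]. The value is [m] times that of [mean_psi_sqr], in accordance with the
    information identity. *)
Lemma mean_dpsi : \int[P]_w dpsi (X w - theta) = (2 * m - 1) / (m + 1).
Proof.
rewrite (_ : (fun w => _) = (fun w => 4 * u (X w - theta) ^+ 2 - 2 * u (X w - theta))); last first.
  by apply/funext => w; rewrite /dpsi /u; field; rewrite one_sqr_neq0.
rewrite bexpB; [|exact: bounded_mfunZ|exact: bounded_mfunZ].
rewrite !bexpZ// mean_u mean_u2; field.
by rewrite !gt_eqF//; have := m0; lra.
Qed.

End pvii_moments.

(** * Positivity of the Kullback-Leibler divergence *)

(** Up to the factor [- m] and an additive constant, this is the logarithm of the density. *)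
Definition lnsq {R : realType} (y : R) : R := ln (1 + y ^+ 2).

Section lnsq.
Context {R : realType}.
Implicit Types x y s : R.

Lemma continuous_lnsq : continuous (@lnsq R).
Proof. exact: derive_continuous derive_ln_one_sqr. Qed.

Lemma lnsq_lipschitz x y : `|lnsq x - lnsq y| <= `|x - y|.
Proof.
by rewrite -[leRHS]mul1r; apply: lipschitz_derive_bound derive_ln_one_sqr psi_le1 x y.
Qed.

Lemma lnsq_inj x y : lnsq x = lnsq y -> x ^+ 2 = y ^+ 2.
Proof.
move=> h; have : 1 + x ^+ 2 = 1 + y ^+ 2.
  by apply: ln_inj h; rewrite posrE one_sqr_gt0.
by move/addrI.
Qed.

End lnsq.

Section kullback.
Context {d} {T : measurableType d} {R : realType} (P : probability T R).
Variables (X : {RV P >-> R}) (m theta : R).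
Hypotheses (hm : 2^-1 < m) (hlaw : has_law_pvii X m theta).
Local Notation leb := (@lebesgue_measure R).
Let q (y : R) := pvii_f m y.

Let m0 : 0 < m. Proof. by apply: lt_trans hm; rewrite invr_gt0. Qed.

Let qE y : q y = pvii_c m * expR (- m * lnsq y).
Proof. by rewrite /q /pvii_f /powR gt_eqF// one_sqr_gt0. Qed.

Let cq : continuous q.
Proof.
rewrite (_ : q = fun y => pvii_c m * expR (- m * lnsq y)); last exact/funext/qE.
move=> y; apply: cvgMl_tmp; apply: (@continuous_comp _ _ _ (fun y => - m * lnsq y) expR).
  by apply: cvgMl_tmp; exact: continuous_lnsq.
exact: continuous_expR.
Qed.

Let cqX : continuous (fun x => q (x - theta)).
Proof.
move=> x; apply: (@continuous_comp _ _ _ (fun x => x - theta) q); last exact: cq.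
by apply: cvgB; [exact: cvg_id|exact: cvg_cst].
Qed.

Let q0 y : 0 <= q y. Proof. exact/ltW/(pvii_f_gt0 hlaw). Qed.

Let integral_shift s : (\int[leb]_x (q (x - theta - s))%:E = 1)%E.
Proof.
pose F (x : R) := x - s.
have dF (x : R) : is_derive x 1 F 1.
  by refine (is_derive_eq (derive_funB (derive_fun_id _) (derive_fun_cst _ _)) _); rewrite subr0.
have F1 : F^`()%classic = cst 1.
  by apply/funext => x; rewrite derive1E; exact: (@derive_val _ _ _ _ _ _ _ (dF x)).
transitivity (\int[leb]_x (q (x - theta))%:E)%E; last first.
  by rewrite -hlaw// preimage_setT; exact: probability_setT.
have FT : {homo F : x y / x < y} by move=> x y xy; rewrite /F ltrD2r.
have cF1 : continuous F^`()%classic by rewrite F1 => x; exact: cvg_cst.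
have cvF1 (H : set_system R) : Filter H -> cvg (F^`()%classic x @[x --> H]).
  by move=> FH; rewrite F1; exact: is_cvg_cst.
have FNy : F x @[x --> -oo] --> -oo by exact: cvg_addrr_Ny.
have Fy : F x @[x --> +oo] --> +oo by exact: cvg_addrr.
have dF' (x : R) : derivable F x 1 by exact: (@ex_derive _ _ _ _ _ _ _ (dF x)).
rewrite (increasing_ge0_integration_by_substitutionT FT cF1 (cvF1 _ _) (cvF1 _ _)
  dF' FNy Fy cqX (fun x => q0 _)).
by apply: eq_integral => x _; rewrite F1 fctE /= mulr1 /F addrAC.
Qed.

Let P_point (a : R) : P (X @^-1` [set a]) = 0%E.
Proof. by rewrite hlaw// integral_set1. Qed.

(** The likelihood ratio [G = exp (- m D)] has mean [1], so [m] times the mean of [D] is the mean of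
    [g = G - 1 + m D], nonnegative because [exp x >= 1 + x]. Mean zero would force [D = 0] almost
    surely, concentrating [X] at the single point [theta + s / 2], which has probability zero. *)
Lemma mean_lnsq_gt0 s : s != 0 ->
  0 < \int[P]_w (lnsq (X w - theta - s) - lnsq (X w - theta)).
Proof.
move=> s0; pose D y := lnsq (y - s) - lnsq y.
have cD : continuous D.
  move=> y; apply: cvgB; last exact: continuous_lnsq.
  apply: (@continuous_comp _ _ _ (fun y => y - s) lnsq); last exact: continuous_lnsq.
  by apply: cvgB; [exact: cvg_id|exact: cvg_cst].
have DM y : `|D y| <= `|s|.
  by rewrite (le_trans (lnsq_lipschitz _ _))// addrAC subrr sub0r normrN.
pose G y := expR (- m * D y).
have cG : continuous G.
  move=> y; apply: (@continuous_comp _ _ _ (fun y => - m * D y) expR).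
    by apply: cvgMl_tmp; exact: cD.
  exact: continuous_expR.
have GM y : `|G y| <= expR (m * `|s|).
  rewrite ger0_norm ?expR_ge0// ler_expR mulNr -mulrN ler_wpM2l ?(ltW m0)//.
  by rewrite (le_trans (ler_norm _))// normrN.
have bD := bounded_mfun_RV_shift X theta cD DM.
have bG := bounded_mfun_RV_shift X theta cG GM.
have EG : \int[P]_w G (X w - theta) = 1.
  rewrite (bexp_pvii hlaw cG GM) /Rintegral -[RHS]/(fine 1%E) -(integral_shift s).
  congr fine; apply: eq_integral => x _; congr EFin.
  rewrite -/(q (x - theta)) -/(q (x - theta - s)) !qE /G /D mulrCA -expRD.
  by congr (_ * expR _); ring.
pose g y := G y - 1 + m * D y.
have g0 y : 0 <= g y by have := expR_ge1Dx (- m * D y); rewrite /g /G; lra.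
have gD y : g y = 0 -> D y = 0.
  move=> gy; apply/eqP; apply: contraT => Dy.
  have /expR_gt1Dx : - m * D y != 0 by rewrite mulf_neq0// oppr_eq0 gt_eqF.
  by move: gy; rewrite /g /G; lra.
have bg : bounded_mfun (fun w => g (X w - theta)).
  apply: bounded_mfunD; last exact: bounded_mfunZ.
  by apply: bounded_mfunB => //; exact: bounded_mfun_cst.
have Eg : \int[P]_w g (X w - theta) = m * \int[P]_w D (X w - theta).
  rewrite /g bexpD; last 2 first.
    by apply: bounded_mfunB => //; exact: bounded_mfun_cst.
    exact: bounded_mfunZ.
  by rewrite bexpB ?EG ?bexp_cst ?subrr ?add0r ?bexpZ//; exact: bounded_mfun_cst.
rewrite ltNge; apply/negP => ED0.
have Eg0 : \int[P]_w g (X w - theta) = 0.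
  apply/eqP; rewrite eq_le; apply/andP; split; last exact: Rintegral_ge0.
  by rewrite Eg mulr_ge0_le0// ltW.
have ig := bounded_mfun_integrable P bg.
have : ae_eq P setT (EFin \o (fun w => g (X w - theta))) (cst 0%E).
  apply/ae_eq_integral_abs => //; first exact: measurable_int ig.
  under eq_integral do rewrite /= ger0_norm//.
  by rewrite -[LHS]fineK ?(integrable_fin_num _ ig)// -/(Rintegral _ _ _) Eg0.
case=> N [mN N0 hN].
(* [D y = 0] means [(y - s)^2 = y^2], whose only solution for nonzero [s] is [y = s / 2]. *)
have cov : [set: T] `<=` N `|` X @^-1` [set theta + s / 2].
  move=> w _; have [gw|gw] := eqVneq (g (X w - theta)) 0; last first.
    by left; apply: hN => /= /(_ I) [] /eqP; rewrite (negbTE gw).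
  right; have /eqP := gD _ gw; rewrite /D subr_eq0 => /eqP/lnsq_inj h /=.
  have : s * (s - 2 * (X w - theta)) = 0.
    by rewrite -[RHS](subrr ((X w - theta) ^+ 2)) -[X in _ = X - _]h; ring.
  by move/eqP; rewrite mulf_eq0 (negbTE s0)/= => /eqP; lra.
have mX : measurable (X @^-1` [set theta + s / 2]).
  by rewrite -[X in measurable X]setTI; exact: measurable_funP.
have covT : [set: T] = N `|` X @^-1` [set theta + s / 2].
  by apply/seteqP; split.
have PN0 : P N = 0%E := N0.
have PT : P [set: T] = 1%E := probability_setT P.
have PA := P_point (theta + s / 2).
set A := X @^-1` _ in PA mX covT.
have : (P (N `|` A) <= P N + P A)%E by exact: measureU2.
by rewrite -covT PN0 PA adde0 PT leNgt lte01.
Qed.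

End kullback.

(** * Consistency *)

Section consistency.
Context {d} {T : measurableType d} {R : realType} (P : probability T R).
Variables (X : nat -> {RV P >-> R}) (m theta : R).
Hypotheses (hm : 2^-1 < m) (hind : mutually_independent X).
Hypothesis hlaw : forall i, has_law_pvii (X i) m theta.

Lemma pvii_identically_distributed i (A : set R) : measurable A ->
  P (X i @^-1` A) = P (X 0%N @^-1` A).
Proof. by move=> mA; rewrite !hlaw. Qed.

Lemma weak_law_mean (h : R -> R) (e : R) : bounded_mfun h -> 0 < e ->
  whp P (fun n => [set w | `|n%:R^-1 * \sum_(0 <= i < n) h (X i w) -
                            \int[P]_w h (X 0%N w)| < e]).
Proof.
move=> bh e0; rewrite bexp_distribution//.
exact: (weak_law hind pvii_identically_distributed).
Qed.

(** Times [m * n], this is the log-likelihood at [theta] minus that at [theta + s]; it is positive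
    when [theta] is the likelier location. *)
Definition mean_lnsq_diff n w s :=
  n%:R^-1 * \sum_(0 <= i < n) (lnsq (X i w - theta - s) - lnsq (X i w - theta)).
Local Notation Dbar := mean_lnsq_diff.

Let mean_ge (h k : R -> R) (n : nat) w : (forall x, h x <= k x) ->
  n%:R^-1 * \sum_(0 <= i < n) h (X i w) <= n%:R^-1 * \sum_(0 <= i < n) k (X i w).
Proof. by move=> hk; rewrite ler_wpM2l ?invr_ge0//; apply: ler_sum. Qed.

Lemma mean_lnsq_diff_lipschitz n w s t : (0 < n)%N -> Dbar n w s <= Dbar n w t + `|s - t|.
Proof.
move=> n0; rewrite -lerBlDl -mulrBr -sumrB.
have nR : 0 < n%:R :> R by rewrite ltr0n.
rewrite ler_pdivrMl//.
rewrite (_ : n%:R * _ = \sum_(0 <= i < n) `|s - t|); last first.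
  by rewrite big_const_nat subn0 iter_addr_0 mulr_natl.
apply: ler_sum => i _; set y := X i w - theta.
rewrite (_ : _ - _ - _ = lnsq (y - s) - lnsq (y - t)); last by ring.
apply: le_trans (ler_norm _) _; apply: le_trans (lnsq_lipschitz _ _) _.
by rewrite (_ : y - s - (y - t) = - (s - t)) ?normrN//; ring.
Qed.

(** The weak law puts the average at [s] above half its mean [K], and the Lipschitz bound loses less
    than [K / 2] within that radius. *)
Let local_pos s : s != 0 -> exists2 r, 0 < r &
  whp P (fun n => [set w | forall t, `|s - t| < r -> 0 < Dbar n w t]).
Proof.
move=> s0; have K0 := mean_lnsq_gt0 hm (hlaw 0) s0.
set K := Rintegral _ _ _ in K0.
have K20 : 0 < K / 2 by rewrite divr_gt0.
exists (K / 2) => //.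
have bh : bounded_mfun (fun x : R => lnsq (x - theta - s) - lnsq (x - theta)).
  apply: (@bounded_mfun_shift _ theta (fun y => lnsq (y - s) - lnsq y) `|s|).
    move=> y; apply: cvgB; last exact: continuous_lnsq.
    apply: (@continuous_comp _ _ _ (fun y => y - s) lnsq); last exact: continuous_lnsq.
    by apply: cvgB; [exact: cvg_id|exact: cvg_cst].
  move=> y; rewrite (le_trans (lnsq_lipschitz _ _))// addrAC subrr sub0r normrN//.
apply: whpS (weak_law_mean bh K20) _.
near=> n => w /= hw t st.
have n0 : (0 < n)%N by near: n; exact: nbhs_infty_gt.
have h1 := mean_lnsq_diff_lipschitz w s t n0.
move: hw; rewrite -/K -/(Dbar n w s) ltr_norml => /andP[hw _].
by lra.
Unshelve. all: end_near. Qed.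

(** Finitely many of the balls from [local_pos] cover the interval, and finitely many events of high
    probability can be intersected. *)
Let compact_pos a b : (forall s, a <= s <= b -> s != 0) ->
  whp P (fun n => [set w | forall t, a <= t <= b -> 0 < Dbar n w t]).
Proof.
move=> ab0.
have /choice[r hr] : forall s, exists r, s != 0 -> 0 < r /\
    whp P (fun n => [set w | forall t, `|s - t| < r -> 0 < Dbar n w t]).
  (* The radius [0] at the origin is a dummy value: the interval avoids this point. *)
  move=> s; have [->|s0] := eqVneq s 0; first by exists 0.
  by have [r r0 hr] := local_pos s0; exists r.
have := @segment_compact R a b; rewrite compact_cover => cc.
have [||F FD cF] := cc R `[a, b]%classic (fun s => ball s (r s)).
- by move=> s; rewrite /= in_itv/= => /ab0 /hr[r0 _]; exact: ball_open.
- move=> s /= sab; exists s => //=; apply: ballxx.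
  by move: sab; rewrite in_itv/= => /ab0 /hr[].
have whpF : whp P (fun n => [set w | forall s, s \in finmap.enum_fset F ->
    forall t, `|s - t| < r s -> 0 < Dbar n w t]).
  have : {subset finmap.enum_fset F <= `[a, b]} by move=> s /FD; rewrite inE.
  elim: (finmap.enum_fset F) => [|s l ih] sl.
    by apply: whpS (whpT P) _; apply: nearW => n w _.
  have /ih whpl : {subset l <= `[a, b]} by move=> t tl; apply: sl; rewrite inE tl orbT.
  have /sl : s \in s :: l by rewrite inE eqxx.
  rewrite in_itv/= => /ab0 /hr[_ whps].
  apply: whpS (whpI whps whpl) _; apply: nearW => n w /= [h1 h2] s'.
  by rewrite inE => /predU1P[->|/h2].
apply: whpS whpF _; apply: nearW => n w /= hw t tab.
have [|s sF st] := cF t; first by rewrite /= in_itv.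
exact: hw sF t st.
Qed.

(** For large [M] each tail has probability below [1 / 8]. The integrand is the indicator of the
    central interval, written through its two disjoint tails. *)
Let tail_bound : exists2 M, 0 < M &
  3 / 4 < \int[P]_w (1 - \1_`]-oo, theta - M] (X 0%N w) - \1_`]theta + M, +oo[ (X 0%N w)) :> R.
Proof.
have e8 : 0 < 8^-1 :> R by rewrite invr_gt0.
have c1 : fine (cdf (X 0%N) x) @[x --> -oo] --> 0.
  by apply: fine_cvg; exact: cvg_cdfNy0.
have c2 : fine (ccdf (X 0%N) x) @[x --> +oo] --> 0.
  by apply: fine_cvg; exact: cvg_ccdfy0.
have {}c1 : fine (cdf (X 0%N) (theta - M)) @[M --> +oo] --> 0.
  apply: (cvg_comp (fun M => theta - M) (fun x => fine (cdf (X 0%N) x)) _ c1).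
  apply/cvgrNyPle => A; near=> M; rewrite lerBlDr -lerBlDl.
  by near: M; apply: nbhs_pinfty_ge; exact: num_real.
have {}c2 : fine (ccdf (X 0%N) (theta + M)) @[M --> +oo] --> 0.
  by apply: (cvg_comp (fun M => theta + M) _ _ c2); exact: cvg_addrl.
have /cvgrPdist_lt/(_ _ e8) n1 := c1.
have /cvgrPdist_lt/(_ _ e8) n2 := c2.
have [M [M0 [h1 h2]]] : exists M, 0 < M /\
    (`|0 - fine (cdf (X 0%N) (theta - M))| < 8^-1 /\
    `|0 - fine (ccdf (X 0%N) (theta + M))| < 8^-1).
  apply: (@filter_ex _ +oo%R); near=> M; split; last split; near: M => //.
  by apply: nbhs_pinfty_gt; exact: num_real.
exists M => //.
have b1 : bounded_mfun (fun w => \1_`]-oo, theta - M] (X 0%N w) : R).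
  apply: (@bounded_mfun_comp _ _ _ _ _ (\1_`]-oo, theta - M] : R -> R) (X 0%N)) => //.
  exact: bounded_mfun_indic.
have b2 : bounded_mfun (fun w => \1_`]theta + M, +oo[ (X 0%N w) : R).
  apply: (@bounded_mfun_comp _ _ _ _ _ (\1_`]theta + M, +oo[ : R -> R) (X 0%N)) => //.
  exact: bounded_mfun_indic.
rewrite bexpB//; last by apply: bounded_mfunB => //; exact: bounded_mfun_cst.
rewrite bexpB//; last exact: bounded_mfun_cst.
rewrite bexp_cst.
have ind (A : set R) : measurable A ->
    \int[P]_w \1_A (X 0%N w) = fine (P (X 0%N @^-1` A)) :> R.
  move=> mA; rewrite -bexp_indic//.
  by rewrite -[X in measurable X]setTI; exact: measurable_funP.
rewrite !ind//.
move: h1 h2; rewrite !sub0r !normrN /cdf /ccdf /distribution /pushforward.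
rewrite !ger0_norm ?fine_ge0//; lra.
Unshelve. all: end_near. Qed.

(** This is the logarithm of [1 + s^2 <= 2 (1 + y^2) (1 + (y - s)^2)], which rests on
    [(2 y - s)^2 >= 0]. *)
Let lnsq_triangle (y s : R) : lnsq s <= ln 2 + lnsq y + lnsq (y - s).
Proof.
rewrite /lnsq -!lnM ?posrE ?mulr_gt0 ?one_sqr_gt0//.
rewrite ler_ln ?posrE ?mulr_gt0 ?one_sqr_gt0//.
have h1 := sqr_ge0 (2 * y - s); have h2 := sqr_ge0 (y * (y - s)).
by nra.
Qed.

Let lnsqN (y : R) : lnsq (- y) = lnsq y. Proof. by rewrite /lnsq sqrrN. Qed.

Let lnsq_ge0 (y : R) : 0 <= lnsq y.
Proof. by rewrite /lnsq ln_ge0// lerDl sqr_ge0. Qed.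

Let lnsq_le (y M : R) : `|y| <= M -> lnsq y <= lnsq M.
Proof.
move=> yM; rewrite /lnsq ler_ln ?posrE ?one_sqr_gt0// lerD2l.
by rewrite -[leLHS]real_normK ?num_real// ler_sqr// nnegrE (le_trans _ yM).
Qed.

(** With [L = lnsq t], an observation within [M] of [theta] contributes at least
    [L - ln 2 - 2 lnsq M], any other at least [- L - ln 2]. More than three quarters are of the
    first kind, so the average is positive for large [L]. *)
Let far_pos : exists2 B, 0 < B &
  whp P (fun n => [set w | forall t, B <= `|t| -> 0 < Dbar n w t]).
Proof.
have [M M0 EM] := tail_bound.
set chi := fun x : R => 1 - \1_`]-oo, theta - M] x - \1_`]theta + M, +oo[ x : R.
have bchi : bounded_mfun chi.
  apply: bounded_mfunB; last exact: bounded_mfun_indic.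
  by apply: bounded_mfunB; [exact: bounded_mfun_cst|exact: bounded_mfun_indic].
(* At proportion [3 / 4] the lower bound is [L / 2 - ln 2 - (3 / 2) lnsq M], positive once [L >= K];
   [|t| >= exp K] ensures this, as [1 + t^2 >= |t|]. *)
pose K := 2 * ln 2 + 3 * lnsq M + 1.
exists (expR K); first exact: expR_gt0.
have e0 : 0 < \int[P]_w chi (X 0%N w) - 3 / 4 by rewrite subr_gt0.
apply: whpS (weak_law_mean bchi e0) _.
near=> n => w /= hw t Bt.
have n0 : (0 < n)%N by near: n; exact: nbhs_infty_gt.
have nR : 0 < n%:R :> R by rewrite ltr0n.
have ln20 : 0 < ln 2 :> R by rewrite ln_gt0// ltr1n.
have LK : K <= lnsq t.
  rewrite /lnsq -[leLHS]expRK ler_ln ?posrE ?expR_gt0 ?one_sqr_gt0//.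
  have : `|t| ^+ 2 = t ^+ 2 by rewrite real_normK ?num_real.
  set a := `|t| in Bt *; have : 0 <= (a - 1) ^+ 2 by exact: sqr_ge0.
  by nra.
have lM := lnsq_ge0 M.
set L := lnsq t in LK *.
have low x : (- ln 2 - L) + 2 * (L - lnsq M) * chi x <=
    lnsq (x - theta - t) - lnsq (x - theta).
  have t1 := lnsq_triangle (x - theta) t.
  have t2 := lnsq_triangle t (x - theta).
  rewrite -[t - _]opprB lnsqN in t2.
  have LM : 0 <= L - lnsq M by rewrite /K in LK; lra.
  rewrite /chi !indicE !mem_setE !in_itv/= andbT.
  have [xl|xl] := leP x (theta - M).
    have -> : (theta + M < x) = false by apply/negbTE; rewrite -leNgt; lra.
    by rewrite /= /L; lra.
  have [xr|xr] := ltP (theta + M) x; first by rewrite /= /L; lra.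
  have : lnsq (x - theta) <= lnsq M.
    by apply: lnsq_le; rewrite ler_norml; apply/andP; split; lra.
  by rewrite /= /L; lra.
have := mean_ge n w low.
rewrite -/(Dbar n w t) big_split/= -mulr_sumr big_const_nat subn0 iter_addr_0.
rewrite mulrDr -[X in _ * X + _]mulr_natl mulKf ?gt_eqF// mulrCA.
move: hw; rewrite ltr_norml => /andP[hw _].
set p := n%:R^-1 * _ in hw *.
have p34 : 3 / 4 < p by lra.
have LM : 0 < L - lnsq M by rewrite /K in LK; lra.
have : 2 * (L - lnsq M) * (3 / 4) <= 2 * (L - lnsq M) * p by rewrite ler_wpM2l ?mulr_ge0// ltW.
by rewrite /K in LK; lra.
Unshelve. all: end_near. Qed.

Lemma whp_mean_lnsq_diff_gt0 e : 0 < e ->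
  whp P (fun n => [set w | forall t, e <= `|t| -> 0 < Dbar n w t]).
Proof.
move=> e0; have [B B0 far] := far_pos.
have c1 : whp P (fun n => [set w | forall t, e <= t <= B -> 0 < Dbar n w t]).
  by apply: compact_pos => s /andP[es _]; rewrite gt_eqF// (lt_le_trans e0).
have c2 : whp P (fun n => [set w | forall t, - B <= t <= - e -> 0 < Dbar n w t]).
  by apply: compact_pos => s /andP[_ es]; rewrite lt_eqF//; lra.
apply: whpS (whpI far (whpI c1 c2)) _; apply: nearW => n w /= [hf [h1 h2]] t et.
have [tB|Bt] := leP B `|t|; first exact: hf.
have [t0|t0] := leP 0 t.
  by apply: h1; move: et Bt; rewrite ger0_norm// => -> /ltW ->.
by apply: h2; move: et Bt; rewrite ltr0_norm// => ? ?; apply/andP; split; lra.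
Qed.

End consistency.

(** * Asymptotic normality *)

Lemma derive_fun_sum {R : realType} (I : Type) (r : seq I) (f : I -> R -> R)
    (df : I -> R) (x : R) :
  (forall i, is_derive x 1 (f i) (df i)) ->
  is_derive x 1 (fun y => \sum_(i <- r) f i y) (\sum_(i <- r) df i).
Proof.
move=> fdf; elim: r => [|i r ih].
  rewrite big_nil (_ : (fun y => _) = fun _ : R => 0); first exact: derive_fun_cst.
  by apply/funext => y; rewrite big_nil.
rewrite big_cons (_ : (fun y => _) = fun y => f i y + \sum_(j <- r) f j y).
  exact: derive_funD.
by apply/funext => y; rewrite big_cons.
Qed.

Lemma global_min_derive0 {R : realType} (f df : R -> R) (x : R) :
  (forall y : R, is_derive y 1 f (df y)) -> (forall y, f x <= f y) -> df x = 0.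
Proof.
move=> fdf fmin.
have d0 : is_derive x 1 f 0.
  apply: (@derive1_at_min _ f (x - 1) (x + 1)) => [|y _||y _ //]; first by lra.
    exact: (@ex_derive _ _ _ _ _ _ _ (fdf y)).
  by rewrite in_itv/=; apply/andP; split; lra.
by rewrite -(@derive_val _ _ _ _ _ _ _ (fdf x)) (@derive_val _ _ _ _ _ _ _ d0).
Qed.

(** For [k < 1] the maps [y + k |y|] and [y - k |y|] are increasing, so off the exceptional set the
    relative error only shifts the threshold [x] by [k |x|], which continuity of [F] absorbs. *)
Lemma cvg_cdf_relative_perturbation {d} {T : measurableType d} {R : realType}
    (P : probability T R) (W Y : nat -> T -> R) (F : R -> R) (x : R) :
  (forall n, measurable_fun setT (W n)) -> (forall n, measurable_fun setT (Y n)) ->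
  continuous F ->
  (forall z, fine (P [set w | W n w <= z]) @[n --> \oo] --> F z) ->
  (forall k, 0 < k -> whp P (fun n => [set w | `|W n w - Y n w| <= k * `|Y n w|])) ->
  fine (P [set w | Y n w <= x]) @[n --> \oo] --> F x.
Proof.
move=> mW mY cF WF WY.
have mle (Z : T -> R) z : measurable_fun setT Z -> measurable [set w | Z w <= z].
  move=> mZ; rewrite -[X in measurable X]setTI.
  rewrite (_ : [set _ | _] = Z @^-1` `]-oo, z]); first exact: mZ.
  by apply/seteqP; split => w /=; rewrite in_itv.
apply/cvgrPdist_le => /= e e0.
have e3 : 0 < e / 3 by rewrite divr_gt0.
have /cvgrPdist_le/(_ _ e3) := cF x.
rewrite near_simpl => /nbhs_ballP[r /= r0 hr].
(* The first bound keeps the shift [k |x|] below [r], the second keeps [k < 1]. *)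
pose k := Num.min (r / 2 / (1 + `|x|)) (1 / 2).
have x1 : 0 < 1 + `|x| by rewrite ltr_pwDl.
have k0 : 0 < k by rewrite lt_min !divr_gt0.
have k1 : k < 1 by rewrite gt_min; apply/orP; right; lra.
have kx : k * `|x| < r.
  have k2 : k <= r / 2 / (1 + `|x|) by rewrite ge_min lexx.
  apply: (@le_lt_trans _ _ (k * (1 + `|x|))); first by rewrite ler_wpM2l ?(ltW k0)// lerDr.
  rewrite -ltr_pdivlMr// (le_lt_trans k2)// ltr_pM2r ?invr_gt0//.
  by rewrite ltr_pdivrMr// ltr_pMr// ltr1n.
have kx0 : 0 <= k * `|x| by rewrite mulr_ge0// ltW.
have Fp : `|F x - F (x + k * `|x|)| <= e / 3.
  by apply: hr; rewrite /ball/= opprD addNKr normrN ger0_norm.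
have Fm : `|F x - F (x - k * `|x|)| <= e / 3.
  by apply: hr; rewrite /ball/= subKr ger0_norm.
have [E [mE cE hE]] := WY k k0.
have /cvgrPdist_le/(_ _ e3) c0 := cE.
have /cvgrPdist_le/(_ _ e3) c1 := WF (x + k * `|x|).
have /cvgrPdist_le/(_ _ e3) c2 := WF (x - k * `|x|).
near=> n.
have d0 : `|0 - fine (P (E n))| <= e / 3 by near: n.
have d1 : `|F (x + k * `|x|) - fine (P [set w | W n w <= x + k * `|x|])| <= e / 3 by near: n.
have d2 : `|F (x - k * `|x|) - fine (P [set w | W n w <= x - k * `|x|])| <= e / 3 by near: n.
have EA : ~` E n `<=` [set w | `|W n w - Y n w| <= k * `|Y n w|] by near: n.
have subadd A B : measurable A -> measurable B -> A `<=` B `|` E n ->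
    fine (P A) <= fine (P B) + fine (P (E n)).
  move=> mA mB AB; rewrite -fineD ?fin_num_measure// fine_le ?fin_numD ?fin_num_measure//.
  apply: (@le_trans _ _ (P (B `|` E n))); last exact: measureU2.
  by apply: le_measure => //; rewrite inE//; exact: measurableU.
have u1 : fine (P [set w | Y n w <= x]) <=
    fine (P [set w | W n w <= x + k * `|x|]) + fine (P (E n)).
  apply: subadd; [exact: mle|exact: mle|move=> w /= Yx].
  have [?|/EA/= h] := pselect (E n w); [by right|left].
  have {h} : W n w - Y n w <= k * `|Y n w| by apply: le_trans (ler_norm _) h.
  have [Y0|Y0] := leP 0 (Y n w); have [x0|x0] := leP 0 x.
  - by rewrite (ger0_norm Y0) (ger0_norm x0); nra.
  - by lra.
  - by rewrite (ltr0_norm Y0) (ger0_norm x0); nra.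
  - by rewrite (ltr0_norm Y0) (ltr0_norm x0); nra.
have u2 : fine (P [set w | W n w <= x - k * `|x|]) <=
    fine (P [set w | Y n w <= x]) + fine (P (E n)).
  apply: subadd; [exact: mle|exact: mle|move=> w /= Wx].
  have [?|/EA/= h] := pselect (E n w); [by right|left].
  have {h} h : Y n w - W n w <= k * `|Y n w|.
    by apply: le_trans (ler_norm _) _; rewrite distrC.
  rewrite leNgt; apply/negP => xY; move: h Wx.
  have [Y0|Y0] := leP 0 (Y n w); have [x0|x0] := leP 0 x.
  - by rewrite (ger0_norm Y0) (ger0_norm x0); nra.
  - by rewrite (ger0_norm Y0) (ltr0_norm x0); nra.
  - by lra.
  - by rewrite (ltr0_norm Y0) (ltr0_norm x0); nra.
have E0 : 0 <= fine (P (E n)) by exact: fine_ge0.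
move: d0; rewrite sub0r normrN (ger0_norm E0) => d0.
move: Fp Fm d1 d2; rewrite !ler_norml => /andP[? ?] /andP[? ?] /andP[? ?] /andP[? ?].
by apply/andP; split; lra.
Unshelve. all: end_near. Qed.

(** * Consistency and linearization of the maximum likelihood estimator *)

Section mle.
Context {d} {T : measurableType d} {R : realType} (P : probability T R).
Variables (X : nat -> {RV P >-> R}) (m theta : R).
Hypotheses (hm : 2^-1 < m) (hind : mutually_independent X).
Hypothesis hlaw : forall i, has_law_pvii (X i) m theta.
Variable thetahat : forall n : nat, n.-tuple R -> R.
Arguments thetahat : clear implicits.
Hypothesis hmeas : forall n : nat, measurable_fun [set: n.-tuple R] (thetahat n).
Hypothesis hmle : forall (n : nat) (x : n.-tuple R) (t : R),
     pvii_likelihood m x t <= pvii_likelihood m x (thetahat n x).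

Let err n w := thetahat n (sample X n w) - theta.

Let m0 : 0 < m. Proof. by apply: lt_trans hm; rewrite invr_gt0. Qed.

Lemma measurable_sample n : measurable_fun setT (sample X n).
Proof.
apply/measurable_fun_tnthP => i.
rewrite (_ : _ \o _ = X i); first exact: measurable_funP.
by apply/funext => w /=; rewrite tnth_mktuple.
Qed.

Let measurable_err n : measurable_fun setT (err n).
Proof.
apply: measurable_funB => //; apply: measurableT_comp; first exact: hmeas.
exact: measurable_sample.
Qed.

Lemma pvii_likelihoodE n w t : pvii_likelihood m (sample X n w) t =
  pvii_c m ^+ n * expR (- m * \sum_(0 <= i < n) lnsq (X i w - t)).
Proof.
rewrite /pvii_likelihood big_mkord mulr_sumr expR_sum.
rewrite -[X in _ ^+ X]card_ord -prodr_const -big_split/=.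
apply: eq_bigr => i _; rewrite tnth_mktuple /pvii_f /powR gt_eqF//.
exact: one_sqr_gt0.
Qed.

Let err_min n w t : \sum_(0 <= i < n) lnsq (X i w - theta - err n w) <=
  \sum_(0 <= i < n) lnsq (X i w - theta - t).
Proof.
have := hmle (sample X n w) (theta + t); rewrite !pvii_likelihoodE.
rewrite ler_pM2l ?exprn_gt0 ?(pvii_c_gt0 (hlaw 0))// ler_expR !mulNr lerN2 ler_pM2l//.
by congr (_ <= _); apply: eq_bigr => i _; rewrite /err; congr lnsq; ring.
Qed.

(** An error of size at least [e] would make the averaged difference positive there, against the
    minimality of the error compared with displacement [0]. *)
Lemma mle_consistent e : 0 < e -> whp P (fun n => [set w | `|err n w| < e]).
Proof.
move=> e0; apply: whpS (whp_mean_lnsq_diff_gt0 hm hind hlaw e0) _.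
apply: nearW => n w /= hw; rewrite ltNge; apply/negP => /hw.
rewrite ltNge => /negP; apply; rewrite /mean_lnsq_diff.
rewrite -[leRHS](mulr0 n%:R^-1) ler_wpM2l ?invr_ge0// sumrB subr_le0.
have := err_min n w 0; congr (_ <= _).
by apply: eq_bigr => i _; rewrite subr0.
Qed.

Lemma score_equation n w : \sum_(0 <= i < n) psi (X i w - theta - err n w) = 0.
Proof.
apply/eqP; rewrite -oppr_eq0 -sumrN; apply/eqP.
apply: (@global_min_derive0 R (fun t => \sum_(0 <= i < n) lnsq (X i w - theta - t))
    (fun t => \sum_(0 <= i < n) - psi (X i w - theta - t)) (err n w)).
  move=> t; apply: derive_fun_sum => i.
  have dB : is_derive t 1 (fun t : R => X i w - theta - t) (- 1).
    by refine (is_derive_eq (derive_funB (derive_fun_cst _ _) (derive_fun_id _)) _); rewrite sub0r.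
  refine (is_derive_eq (derive_fun_comp (f := lnsq) (g := fun t => X i w - theta - t)
    (derive_ln_one_sqr _) dB) _).
  by rewrite mulrN1.
by move=> t; exact: err_min.
Qed.

(** The mean of [dpsi] under the law; [m * I0] is the Fisher information. *)
Let I0 := (2 * m - 1) / (m + 1).

Let I0_gt0 : 0 < I0.
Proof. by rewrite /I0 divr_gt0//; have := m0; have h2 := hm; lra. Qed.

(** The influence function of the estimator, whose variance is the limiting variance. *)
Let g (x : R) := psi (x - theta) / I0.

Let bounded_g : bounded_mfun g.
Proof.
have h : bounded_mfun (fun x : R => psi (x - theta)).
  by apply: bounded_mfun_shift psi_le1; exact: derive_continuous derive_psi.
by apply: bounded_mfunM => //; exact: bounded_mfun_cst.
Qed.

Let mean_g : \int[distribution P (X 0%N)]_x g x = 0.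
Proof.
rewrite -bexp_distribution// /g.
under eq_Rintegral do rewrite mulrC.
rewrite bexpZ ?(mean_psi hm (hlaw 0)) ?mulr0//.
by apply: bounded_mfun_RV_shift psi_le1; exact: derive_continuous derive_psi.
Qed.

Let sigma := Num.sqrt ((m + 1) / (m * (2 * m - 1))).

Let var_gt0 : 0 < (m + 1) / (m * (2 * m - 1)).
Proof. by rewrite divr_gt0 ?mulr_gt0//; have := m0; have h2 := hm; lra. Qed.

Let sigma_gt0 : 0 < sigma. Proof. by rewrite sqrtr_gt0. Qed.

Let mean_g_sqr : \int[distribution P (X 0%N)]_x g x ^+ 2 = sigma ^+ 2.
Proof.
have bg2 : bounded_mfun (fun x => g x ^+ 2) by exact: (bounded_mfunM bounded_g bounded_g).
rewrite -(bexp_distribution (X 0%N) bg2) /g sqr_sqrtr ?(ltW var_gt0)//.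
under eq_Rintegral do rewrite exprMn mulrC.
rewrite bexpZ; last first.
  have h : bounded_mfun (fun w => psi (X 0%N w - theta)).
    by apply: bounded_mfun_RV_shift psi_le1; exact: derive_continuous derive_psi.
  exact: (bounded_mfunM h h).
rewrite (mean_psi_sqr hm (hlaw 0)) /I0; field.
by rewrite !gt_eqF//; have := m0; have h2 := hm; lra.
Qed.

(** Averaging the Taylor expansion of [psi] at the [X i - theta] and using the score equation shows
    that the mean score is close to [s * J], with [J] close to [I0] by the weak law. Both errors are
    proportional to [|s|], hence relative. *)
Let linearization k : 0 < k -> whp P (fun n => [set w |
  `|normalized_sum X g n w - Num.sqrt n%:R * err n w| <= k * `|Num.sqrt n%:R * err n w|]).
Proof.
(* The Taylor error and the weak-law error each cost [|s| * e]; after division by [I0] they total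
   [k * |s|]. *)
move=> k0; pose e := k * I0 / 2.
have I1 := I0_gt0; have e0 : 0 < e by apply: divr_gt0 => //; exact: mulr_gt0.
(* The divisor [6] is the Lipschitz constant of [dpsi]. *)
have d0 : 0 < e / 6 by rewrite divr_gt0.
have bd : bounded_mfun (fun x : R => dpsi (x - theta)).
  by apply: bounded_mfun_shift dpsi_le2; exact: derive_continuous derive_dpsi.
have := weak_law_mean hind hlaw bd e0.
rewrite (mean_dpsi hm (hlaw 0)) -/I0 => wl.
apply: whpS (whpI (mle_consistent d0) wl) _.
near=> n => w /= [].
have n0 : (0 < n)%N by near: n; exact: nbhs_infty_gt.
have nR : 0 < n%:R :> R by rewrite ltr0n.
set s := err n w => sd; set J := n%:R^-1 * _ => hJ.
have tay i : `|psi (X i w - theta - s) - psi (X i w - theta) + s * dpsi (X i w - theta)|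
    <= `|s| * e.
  have := @taylor1_le R psi dpsi e (e / 6) (X i w - theta) (- s) derive_psi.
  rewrite normrN mulNr opprK; apply => // x y xy.
  apply: le_trans (lipschitz_derive_bound derive_dpsi ddpsi_le x y) _.
  by rewrite mulrC -ler_pdivlMr// ltW.
have h1 : `|n%:R^-1 * \sum_(0 <= i < n) (psi (X i w - theta - s) - psi (X i w - theta) +
    s * dpsi (X i w - theta))| <= `|s| * e.
  rewrite normrM gtr0_norm ?invr_gt0// ler_pdivrMl//.
  apply: le_trans (ler_norm_sum _ _ _) _.
  rewrite (_ : n%:R * _ = \sum_(0 <= i < n) (`|s| * e)); last first.
    by rewrite big_const_nat subn0 iter_addr_0 mulr_natl.
  by apply: ler_sum => i _.
rewrite big_split/= sumrB score_equation sub0r -mulr_sumr mulrDr mulrN mulrCA -/J in h1.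
set p := n%:R^-1 * \sum_(0 <= i < n) psi (X i w - theta) in h1.
have h2 : `|p - s * I0| <= `|s| * (2 * e).
  rewrite (_ : p - s * I0 = - (- p + s * J) + s * (J - I0)); last by ring.
  apply: le_trans (ler_normD _ _) _; rewrite normrN normrM.
  rewrite (_ : `|s| * (2 * e) = `|s| * e + `|s| * e); last by ring.
  by apply: lerD => //; rewrite ler_wpM2l// ltW.
have W_E : normalized_sum X g n w = Num.sqrt n%:R * (p / I0).
  rewrite /normalized_sum /g -mulr_suml /p.
  have -> : n%:R^-1 = (Num.sqrt n%:R)^-1 ^+ 2 :> R by rewrite exprVn sqr_sqrtr// ltW.
  by field; rewrite !gt_eqF ?sqrtr_gt0.
rewrite W_E -mulrBr !normrM (_ : p / I0 - s = (p - s * I0) / I0); last first.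
  by field; rewrite gt_eqF.
rewrite normrM normfV (gtr0_norm I0_gt0) [leRHS]mulrCA ler_wpM2l//.
rewrite ler_pdivrMr//; apply: le_trans h2 _.
by rewrite /e le_eqVlt; apply/orP; left; apply/eqP; field.
Unshelve. all: end_near. Qed.

Lemma mle_asymptotic_cdf x :
  P [set w | Num.sqrt n%:R * err n w <= x] @[n --> \oo] --> (normal_cdf sigma x)%:E.
Proof.
have mY n : measurable_fun setT (fun w => Num.sqrt n%:R * err n w).
  exact: measurable_funM.
apply: cvg_EFin.
  apply: nearW => n; apply: fin_num_measure.
  rewrite (_ : [set _ | _] = (fun w => Num.sqrt n%:R * err n w) @^-1` `]-oo, x]).
    by rewrite -[X in measurable X]setTI; exact: mY.
  by apply/seteqP; split => w /=; rewrite in_itv.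
apply: (cvg_cdf_relative_perturbation (W := normalized_sum X g)
  (Y := fun n w => Num.sqrt n%:R * err n w)) => //.
- by move=> n; exact: (bounded_normalized_sum X bounded_g n).1.
- exact: continuous_normal_cdf.
- by move=> z; apply: central_limit => //; exact: (pvii_identically_distributed hlaw).
Qed.

End mle.

Theorem theorem1p2 (R : realType) (m : R) (hm : 2^-1 < m) (theta : R)
  (d : measure_display) (T : measurableType d) (P : probability T R)
  (X : nat -> {RV P >-> R})
  (hind : mutually_independent X)
  (hlaw : forall i, has_law_pvii (X i) m theta)
  (thetahat : forall n : nat, n.-tuple R -> R)
  (hmeas : forall n : nat, measurable_fun [set: n.-tuple R] (thetahat n))
  (hmle : forall (n : nat) (x : n.-tuple R) (t : R),
     pvii_likelihood m x t <= pvii_likelihood m x (thetahat n x)) :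
  cvg_in_distribution P
    (fun n w => Num.sqrt (n%:R) * (thetahat n (sample X n w) - theta))
    (normal_prob 0 (Num.sqrt ((m + 1) / (m * (2 * m - 1))))).
Proof.
move=> x _.
(* The limiting probability is finite, and its real part is [normal_cdf] at [x]. *)
rewrite -[X in _ --> X](@fineK _ (normal_prob _ _ _)) ?fin_num_measure//.
exact: (mle_asymptotic_cdf hm hind hlaw hmeas hmle).
Qed.
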